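(* Let $g\in\mathcal{S}'(\mathbb{R})$ be supported on $[0,\infty)$ and let $a,b$ be constants. Suppose that $$\mathcal{L}\{g;y\}=a+b\log\left(\frac{1}{y}\right)+o(1),\qquad y\to0^+,$$ and that the Tauberian hypothesis $$g(\lambda x)-b\log\lambda\,\frac{\delta(x)}{\lambda}=O\left(\frac{1}{\lambda}\right),\qquad\lambda\to\infty,\ \text{in }\mathcal{S}'(\mathbb{R}),$$ holds. Then, as $\lambda\to\infty$ in $\mathcal{S}'(\mathbb{R})$, $$g(\lambda x)=(a+b\gamma)\frac{\delta(x)}{\lambda}+b\frac{\log\lambda}{\lambda}\delta(x)+\frac{b}{\lambda}\operatorname{Pf}\left(\frac{H(x)}{x}\right)+o\left(\frac{1}{\lambda}\right),$$ where $\gamma$ is Euler's constant.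
   Context: $\delta$ is the Dirac delta and $H$ the Heaviside function. $\langle \operatorname{Pf}(H(x)/x),\phi\rangle=\int_0^1\frac{\phi(x)-\phi(0)}{x}\,dx+\int_1^\infty\frac{\phi(x)}{x}\,dx$. For a distribution $g$, $g(\lambda x)$ is $\phi\mapsto \lambda^{-1}\langle g(x),\phi(x/\lambda)\rangle$. A relation $F_\lambda=O(c(\lambda))$ (resp. with $o$) in $\mathcal{S}'(\mathbb{R})$ means $\langle F_\lambda,\phi\rangle=O(c(\lambda))$ (resp. $o$) for every $\phi\in\mathcal{S}(\mathbb{R})$; asymptotic expansions in $\mathcal{S}'(\mathbb{R})$ are understood likewise after pairing with test functions. For $g\in\mathcal{S}'(\mathbb{R})$ supported in $[0,\infty)$, $\mathcal{L}\{g;y\}=\langle g(x),e^{-yx}\rangle$, $y>0$. *)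

(* Defs.v *)
From Stdlib Require Import Reals.
From Coquelicot Require Import Coquelicot.

Local Open Scope R_scope.

Notation CC := Coquelicot.Complex.C.

Definition smooth (f : R -> R) : Prop := forall (n : nat) (x : R), ex_derive_n f n x.

Definition cderive_n (phi : R -> CC) (m : nat) (x : R) : CC :=
  (Derive_n (fun t => Re (phi t)) m x, Derive_n (fun t => Im (phi t)) m x).

Definition schwartz (phi : R -> CC) : Prop :=
  smooth (fun t => Re (phi t)) /\ smooth (fun t => Im (phi t)) /\
  forall k m : nat, exists M : R, forall x : R,
      Rabs x ^ k * Cmod (cderive_n phi m x) <= M.

(* Tempered distributions: complex-linear functionals on S(R), continuous for the
   Schwartz topology (bounded by a finite combination of the seminorms
   sup_x |x|^k |phi^(m)(x)|, k,m <= N).  Only the values on Schwartz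
   functions are meaningful. *)
Definition tempered (g : (R -> CC) -> CC) : Prop :=
  (forall phi psi, schwartz phi -> schwartz psi ->
     g (fun x => (phi x + psi x)%C) = (g phi + g psi)%C) /\
  (forall (c : CC) phi, schwartz phi -> g (fun x => (c * phi x)%C) = (c * g phi)%C) /\
  (exists (K : R) (N : nat), forall phi, schwartz phi ->
     forall M : R,
       (forall (x : R) (k m : nat), (k <= N)%nat -> (m <= N)%nat ->
           Rabs x ^ k * Cmod (cderive_n phi m x) <= M) ->
       Cmod (g phi) <= K * M).

Definition supported_nonneg (g : (R -> CC) -> CC) : Prop :=
  forall phi, schwartz phi ->
    (exists d c : R, c < 0 /\ forall x, (x <= d \/ c <= x) -> phi x = 0%C) ->
    g phi = 0%C.

Definition dilate (g : (R -> CC) -> CC) (lam : R) (phi : R -> CC) : CC :=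
  Cmult (RtoC (/ lam)) (g (fun x => phi (x / lam))).

(* Smooth cutoff equal to 1 on a neighbourhood [c,oo) of [0,oo) and 0 on (-oo,d];
   the Laplace transform <g(x), e^{-yx}> of g supported on [0,oo) is
   <g(x), eta(x) e^{-yx}> for any such eta. *)
Definition cutoff (eta : R -> R) : Prop :=
  smooth eta /\ exists d c : R, d < c /\ c < 0 /\
    (forall x, c <= x -> eta x = 1) /\ (forall x, x <= d -> eta x = 0).

Definition laplace (g : (R -> CC) -> CC) (eta : R -> R) (y : R) : CC :=
  g (fun x => RtoC (eta x * exp (- (y * x)))).

Definition Pf_H_over_x (phi : R -> CC) : CC :=
  Cplus (@RInt C_R_CompleteNormedModule (fun x => Cmult (RtoC (/ x)) (Cminus (phi x) (phi 0))) 0 1)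
   (@RInt_gen C_R_CompleteNormedModule (fun x => Cmult (RtoC (/ x)) (phi x)) (at_point 1) (Rbar_locally p_infty)).

Definition euler_gamma : R :=
  real (Lim_seq (fun n : nat => sum_f_R0 (fun k => / INR (S k)) n - ln (INR (S n)))).

(* Main.v *)
(* After rescaling, the Tauberian hypothesis says that the functionals
   f |-> <g, f(x/lam)> - b ln(lam) f(0) are pointwise bounded on S(R) for large lam, hence
   equicontinuous by the Banach-Steinhaus theorem.  It is therefore enough to prove convergence on
   a dense set of test functions.  Modulo functions supported in (-oo, 0) the exponentials
   e^{-yx}, y > 0, span such a set, and on them the Laplace hypothesis gives convergence to
   a - b ln y, which is the value of (a + b gamma) delta + b Pf(H(x)/x) because
   <Pf(H(x)/x), e^{-yx}> = -gamma - ln y.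

   For the density, let f vanish for large x.  The substitution u = e^{-x} and the Weierstrass
   theorem approximate the N-th derivative of f on [-1, oo) by an exponential sum, with error
   eps e^{-x}; integrating N times from infinity controls the lower derivatives as well. *)

Require Import Defs.
From Stdlib Require Import Reals Lra Lia FunctionalExtensionality ClassicalEpsilon Classical.
From Coquelicot Require Import Coquelicot.

Local Open Scope R_scope.

(** * Smooth functions and cutoffs *)

(** Exponentials grow on the negative axis and are not Schwartz functions, so exponential sums are
    multiplied by a cutoff [eta], equal to 0 left of -1 and to 1 right of -1/2. Approximation is
    therefore needed on [-1, oo), and the substitution is shifted to u = e^{-(x+1)}, which maps this
    half-line onto (0, 1]. The weight e^{-x} serves twice: it absorbs the powers of x in the
    seminorms, and it equals its own tail integral, so that integrating from infinity loses no
    constant. It is obtained by applying Weierstrass to f/u instead of f; this quotient extends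
    continuously by 0 to u = 0 because f vanishes for large x. Euler's constant is defined through
    harmonic numbers. It enters by writing H_n as the integral over [0, n] of (1 - (1 - x/n)^n)/x
    and comparing this with the integral of (1 - e^{-x})/x. All estimates concern real test
    functions, on which g still takes complex values; real and imaginary parts are joined only at
    the very end. *)

(** Smoothness from a full list of candidate derivatives. It serves for functions whose derivatives
    are known in advance: exponentials, primitives, and limits of sequences whose derivatives all
    converge. *)
Lemma smooth_of_tower (F : nat -> R -> R) :
  (forall n x, is_derive (F n) x (F (S n) x)) ->
  smooth (F 0%nat) /\ forall n x, Derive_n (F 0%nat) n x = F n x.
Proof.
  intros HF.
  assert (HD : forall n x, Derive_n (F 0%nat) n x = F n x).
  { intros n; induction n as [|n IH]; intros x; [reflexivity|].
    simpl. rewrite (Derive_ext _ (F n) x IH). now apply is_derive_unique. }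
  split; [|exact HD].
  intros [|n] x; [exact I|].
  simpl. apply ex_derive_ext with (F n); [intros t; now rewrite HD|].
  now exists (F (S n) x).
Qed.

Lemma Derive_n_S (f : R -> R) (n : nat) (x : R) :
  Derive_n f (S n) x = Derive_n (Derive f) n x.
Proof.
  change (Derive f) with (Derive_n f 1).
  rewrite Derive_n_comp. now replace (n + 1)%nat with (S n) by lia.
Qed.

Lemma smooth_ex_derive (f : R -> R) (x : R) : smooth f -> ex_derive f x.
Proof. intros H; exact (H 1%nat x). Qed.

Lemma smooth_is_derive (f : R -> R) (x : R) : smooth f -> is_derive f x (Derive f x).
Proof. intros H; apply Derive_correct; now apply smooth_ex_derive. Qed.

Lemma smooth_Derive_n_is_derive (f : R -> R) (n : nat) (x : R) :
  smooth f -> is_derive (Derive_n f n) x (Derive_n f (S n) x).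
Proof. intros H; apply Derive_correct; exact (H (S n) x). Qed.

Lemma smooth_continuous (f : R -> R) (x : R) : smooth f -> continuous f x.
Proof. intros H; apply (ex_derive_continuous (K := R_AbsRing) (V := R_NormedModule)); now apply smooth_ex_derive. Qed.

Lemma smooth_Derive_n_continuous (f : R -> R) (n : nat) (x : R) :
  smooth f -> continuous (Derive_n f n) x.
Proof. intros H; apply (ex_derive_continuous (K := R_AbsRing) (V := R_NormedModule)); exact (H (S n) x). Qed.

Lemma smooth_Derive (f : R -> R) : smooth f -> smooth (Derive f).
Proof.
  intros H [|n] x; [exact I|]. simpl.
  apply ex_derive_ext with (Derive_n f (S n)).
  - intros t; apply Derive_n_S.
  - exact (H (S (S n)) x).
Qed.

Lemma smooth_primitive (F f : R -> R) :
  (forall x, is_derive F x (f x)) -> smooth f -> smooth F.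
Proof.
  intros HF Hf.
  apply (smooth_of_tower (fun n => match n with O => F | S k => Derive_n f k end)).
  intros [|n] x; [apply HF|]. now apply smooth_Derive_n_is_derive.
Qed.

Lemma smooth_const (c : R) : smooth (fun _ => c).
Proof. intros n x; apply ex_derive_n_const. Qed.

Lemma smooth_exp_lin (c : R) :
  smooth (fun x => exp (- (c * x))) /\
  forall n x, Derive_n (fun x => exp (- (c * x))) n x = (- c) ^ n * exp (- (c * x)).
Proof.
  destruct (smooth_of_tower (fun n x => (- c) ^ n * exp (- (c * x)))) as [H1 H2].
  { intros n x. auto_derive; [exact I|]. simpl. ring. }
  assert (E : (fun x => (- c) ^ 0 * exp (- (c * x))) = (fun x => exp (- (c * x)))).
  { extensionality x. simpl. ring. }
  now rewrite E in H1, H2.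
Qed.

Lemma smooth_plus (f h : R -> R) : smooth f -> smooth h -> smooth (fun x => f x + h x).
Proof.
  intros Hf Hh n x.
  apply ex_derive_n_plus; apply filter_forall; intros y k _; [apply Hf|apply Hh].
Qed.

Lemma smooth_minus (f h : R -> R) : smooth f -> smooth h -> smooth (fun x => f x - h x).
Proof.
  intros Hf Hh n x.
  apply ex_derive_n_minus; apply filter_forall; intros y k _; [apply Hf|apply Hh].
Qed.

Lemma smooth_scal (c : R) (f : R -> R) : smooth f -> smooth (fun x => c * f x).
Proof. intros Hf n x; apply ex_derive_n_scal_l, Hf. Qed.

Lemma smooth_scale_arg (c : R) (f : R -> R) : smooth f -> smooth (fun x => f (c * x)).
Proof. intros Hf n x; apply ex_derive_n_comp_scal, filter_forall; intros y k _; apply Hf. Qed.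

Lemma smooth_translate (c : R) (f : R -> R) : smooth f -> smooth (fun x => f (x + c)).
Proof. intros Hf n x; apply ex_derive_n_comp_trans, Hf. Qed.

Lemma Derive_n_smooth_plus (f h : R -> R) (n : nat) (x : R) : smooth f -> smooth h ->
  Derive_n (fun x => f x + h x) n x = Derive_n f n x + Derive_n h n x.
Proof.
  intros Hf Hh.
  apply Derive_n_plus; apply filter_forall; intros y k _; [apply Hf|apply Hh].
Qed.

Lemma Derive_n_smooth_minus (f h : R -> R) (n : nat) (x : R) : smooth f -> smooth h ->
  Derive_n (fun x => f x - h x) n x = Derive_n f n x - Derive_n h n x.
Proof.
  intros Hf Hh.
  apply Derive_n_minus; apply filter_forall; intros y k _; [apply Hf|apply Hh].
Qed.

Lemma Derive_n_scale_arg (c : R) (f : R -> R) (n : nat) (x : R) : smooth f ->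
  Derive_n (fun x => f (c * x)) n x = c ^ n * Derive_n f n (c * x).
Proof. intros Hf; apply Derive_n_comp_scal, filter_forall; intros y k _; apply Hf. Qed.

Lemma Derive_smooth_mult (f h : R -> R) : smooth f -> smooth h ->
  Derive (fun x => f x * h x) = (fun x => Derive f x * h x + f x * Derive h x).
Proof.
  intros Hf Hh. extensionality x.
  apply Derive_mult; now apply smooth_ex_derive.
Qed.

Lemma smooth_mult (f h : R -> R) : smooth f -> smooth h -> smooth (fun x => f x * h x).
Proof.
  intros Hf Hh n. revert f h Hf Hh.
  (* The rule for sums asks for all orders up to n, and the derivative of a product is a sum of two
     other products; hence the induction covers all lower orders and all pairs of factors. *)
  enough (H : forall N n f h, (n <= N)%nat -> smooth f -> smooth h ->
                forall x, ex_derive_n (fun x => f x * h x) n x)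
    by (intros f h Hf Hh x; now apply (H n)).
  intros N; induction N as [|N IH]; intros m f h Hm Hf Hh x.
  - now replace m with 0%nat by lia.
  - destruct m as [|[|m]]; [exact I| |].
    + apply (ex_derive_mult f h x); now apply smooth_ex_derive.
    + simpl.
      apply ex_derive_ext with (Derive_n (Derive (fun x => f x * h x)) m).
      { intros t; symmetry; apply Derive_n_S. }
      rewrite Derive_smooth_mult by assumption.
      change (ex_derive_n (fun x => Derive f x * h x + f x * Derive h x) (S m) x).
      apply ex_derive_n_plus; apply filter_forall; intros y k Hk; apply IH;
        auto using smooth_Derive; lia.
Qed.

(** Leibniz without binomial coefficients: every differentiation doubles the number of terms, whence
    2^m. The estimate is made at a single point x, so A and B may carry weights depending on x. *)
Lemma Derive_n_mult_bound (x A B : R) (m : nat) : forall f h : R -> R,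
  smooth f -> smooth h ->
  (forall i, (i <= m)%nat -> Rabs (Derive_n f i x) <= A) ->
  (forall i, (i <= m)%nat -> Rabs (Derive_n h i x) <= B) ->
  Rabs (Derive_n (fun x => f x * h x) m x) <= 2 ^ m * (A * B).
Proof.
  induction m as [|m IH]; intros f h Hf Hh HA HB.
  - simpl. rewrite Rabs_mult, Rmult_1_l.
    apply Rmult_le_compat; try apply Rabs_pos; [apply (HA 0%nat)|apply (HB 0%nat)]; lia.
  - rewrite Derive_n_S, Derive_smooth_mult by assumption.
    rewrite Derive_n_smooth_plus by auto using smooth_mult, smooth_Derive.
    eapply Rle_trans; [apply Rabs_triang|].
    replace (2 ^ S m * (A * B)) with (2 ^ m * (A * B) + 2 ^ m * (A * B)) by (simpl; ring).
    apply Rplus_le_compat; apply IH; auto using smooth_Derive;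
      intros i Hi; rewrite <- ?Derive_n_S; (apply HA || apply HB); lia.
Qed.

Lemma Derive_n_zero (n : nat) (x : R) : Derive_n (fun _ => 0) n x = 0.
Proof. destruct n; [reflexivity|apply Derive_n_const]. Qed.

Lemma Derive_n_locally_zero (f : R -> R) (n : nat) (x r : R) : 0 < r ->
  (forall y, Rabs (y - x) < r -> f y = 0) -> Derive_n f n x = 0.
Proof.
  intros Hr H.
  rewrite (Derive_n_ext_loc f (fun _ => 0) n x).
  - apply Derive_n_zero.
  - exists (mkposreal r Hr). intros y Hy. apply H. exact Hy.
Qed.

(** * Flat functions and a smooth step *)

Lemma pow_le_exp (k : nat) (y : R) : 0 <= y -> y ^ k <= INR k ^ k * exp y.
Proof.
  intros Hy. destruct k as [|k].
  - simpl. rewrite Rmult_1_l. destruct (Req_dec y 0) as [->|]; [rewrite exp_0; lra|].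
    pose proof (exp_ineq1 y); lra.
  - set (n := S k). assert (Hn : 0 < INR n) by (apply lt_0_INR; unfold n; lia).
    (* The bound is the n-th power of y/n <= e^{y/n}. *)
    assert (E : exp y = exp (y / INR n) ^ n).
    { rewrite <- Rpower_pow by apply exp_pos. unfold Rpower. rewrite ln_exp. f_equal. field; lra. }
    rewrite E, <- Rpow_mult_distr. apply pow_incr. split; [assumption|].
    apply Rmult_le_reg_l with (/ INR n); [now apply Rinv_0_lt_compat|].
    rewrite <- Rmult_assoc, Rinv_l, Rmult_1_l by lra.
    replace (/ INR n * y) with (y / INR n) by (field; lra).
    apply Rle_trans with (1 + y / INR n); [lra|apply exp_ineq1_le].
Qed.

(** The powers of 1/x are included so that the family is closed under differentiation up to linear
    combinations; [flat 0] is the usual e^{-1/x}. *)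
Definition flat (n : nat) (x : R) : R :=
  if Rle_dec x 0 then 0 else (/ x) ^ n * exp (- / x).

Lemma flat_nonpos (n : nat) (x : R) : x <= 0 -> flat n x = 0.
Proof. intros H; unfold flat; now destruct (Rle_dec x 0). Qed.

Lemma flat_pos (n : nat) (x : R) : 0 < x -> flat n x = (/ x) ^ n * exp (- / x).
Proof. intros H; unfold flat; destruct (Rle_dec x 0); [lra|reflexivity]. Qed.

Lemma flat_gt_0 (n : nat) (x : R) : 0 < x -> 0 < flat n x.
Proof.
  intros H; rewrite flat_pos by assumption.
  apply Rmult_lt_0_compat; [now apply pow_lt, Rinv_0_lt_compat|apply exp_pos].
Qed.

(** [pow_le_exp] at 1/x with exponent n + 2: two powers of 1/x are left over. A quadratic bound is
    what makes the derivative at 0 exist and vanish. *)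
Lemma flat_quadratic (n : nat) (x : R) :
  Rabs (flat n x) <= INR (n + 2) ^ (n + 2) * x ^ 2.
Proof.
  assert (Hc : 0 <= INR (n + 2) ^ (n + 2)) by apply pow_le, pos_INR.
  destruct (Rle_lt_dec x 0) as [Hx|Hx].
  - rewrite flat_nonpos, Rabs_R0 by assumption.
    apply Rmult_le_pos; [assumption|apply pow2_ge_0].
  - rewrite Rabs_pos_eq by now left; apply flat_gt_0.
    rewrite flat_pos by assumption.
    assert (Hy : 0 < / x) by now apply Rinv_0_lt_compat.
    pose proof (pow_le_exp (n + 2) (/ x) (Rlt_le _ _ Hy)) as H.
    rewrite pow_add in H at 1.
    apply Rmult_le_reg_r with (exp (/ x) * (/ x) ^ 2).
    { apply Rmult_lt_0_compat; [apply exp_pos|now apply pow_lt]. }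
    replace ((/ x) ^ n * exp (- / x) * (exp (/ x) * (/ x) ^ 2))
      with ((/ x) ^ n * (/ x) ^ 2 * (exp (- / x) * exp (/ x))) by ring.
    rewrite <- exp_plus, Rplus_opp_l, exp_0, Rmult_1_r.
    replace (INR (n + 2) ^ (n + 2) * x ^ 2 * (exp (/ x) * (/ x) ^ 2))
      with (INR (n + 2) ^ (n + 2) * exp (/ x)) by (field; lra).
    exact H.
Qed.

Lemma is_derive_flat (n : nat) (x : R) :
  is_derive (flat n) x (flat (n + 2) x - INR n * flat (n + 1) x).
Proof.
  destruct (Rtotal_order x 0) as [Hx|[->|Hx]].
  - rewrite !flat_nonpos by lra. rewrite Rmult_0_r, Rminus_0_r.
    apply is_derive_ext_loc with (fun _ => 0).
    + assert (H : 0 < - x) by lra. exists (mkposreal _ H). intros y Hy.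
      apply Rabs_def2 in Hy; unfold minus, plus, opp in Hy; simpl in Hy.
      symmetry; apply flat_nonpos; lra.
    + apply (is_derive_const (K := R_AbsRing) (V := R_NormedModule)).
  - rewrite !flat_nonpos by lra. rewrite Rmult_0_r, Rminus_0_r.
    apply is_derive_Reals. intros eps Heps.
    set (K := INR (n + 2) ^ (n + 2)).
    assert (HK : 0 <= K) by apply pow_le, pos_INR.
    assert (Hd : 0 < eps / (K + 1)) by (apply Rdiv_lt_0_compat; lra).
    exists (mkposreal _ Hd). simpl. intros h Hh0 Hh.
    rewrite Rplus_0_l, (flat_nonpos n 0), !Rminus_0_r by lra.
    unfold Rdiv. rewrite Rabs_mult, Rabs_inv.
    assert (Hh' : 0 < Rabs h) by now apply Rabs_pos_lt.
    apply Rle_lt_trans with (K * Rabs h).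
    + apply Rmult_le_reg_r with (Rabs h); [assumption|].
      rewrite Rmult_assoc, Rinv_l, Rmult_1_r by lra.
      replace (K * Rabs h * Rabs h) with (K * h ^ 2)
        by (rewrite <- (pow2_abs h); ring).
      apply flat_quadratic.
    + apply Rle_lt_trans with ((K + 1) * Rabs h).
      { apply Rmult_le_compat_r; lra. }
      replace eps with ((K + 1) * (eps / (K + 1))) by (field; lra).
      apply Rmult_lt_compat_l; lra.
  - rewrite !flat_pos by lra.
    apply is_derive_ext_loc with (fun x => (/ x) ^ n * exp (- / x)).
    + exists (mkposreal _ Hx). intros y Hy.
      apply Rabs_def2 in Hy; unfold minus, plus, opp in Hy; simpl in Hy.
      symmetry; apply flat_pos; lra.
    + auto_derive; [repeat split; lra|].
      rewrite !pow_add. destruct n as [|n]; simpl pred; [simpl; field; lra|].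
      replace ((/ x) ^ S n) with (/ x * (/ x) ^ n) by (simpl; ring).
      rewrite pow_1. field. lra.
Qed.

Lemma smooth_flat (n : nat) : smooth (flat n).
Proof.
  intros m.
  (* Differentiation raises the index of [flat], so the index is generalized while the order of
     derivation decreases. *)
  enough (H : forall N m n, (m <= N)%nat -> forall x, ex_derive_n (flat n) m x)
    by (intros x; now apply (H m)).
  clear n m; intros N; induction N as [|N IH]; intros m n Hm x.
  - now replace m with 0%nat by lia.
  - destruct m as [|[|m]]; [exact I|eexists; apply is_derive_flat|].
    simpl. apply ex_derive_ext with (Derive_n (Derive (flat n)) m).
    { intros t; symmetry; apply Derive_n_S. }
    replace (Derive (flat n)) with (fun x => flat (n + 2) x - INR n * flat (n + 1) x).
    2: { extensionality t; symmetry; apply is_derive_unique, is_derive_flat. }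
    change (ex_derive_n (fun x => flat (n + 2) x - INR n * flat (n + 1) x) (S m) x).
    apply ex_derive_n_minus; apply filter_forall; intros y k Hk.
    + apply IH; lia.
    + apply ex_derive_n_scal_l, IH; lia.
Qed.

(** The normalized primitive of the bump e^{-1/x} e^{-1/(1-x)}, which is positive exactly on (0,
    1). *)
Lemma smooth_step_exists :
  exists s : R -> R, smooth s /\ (forall x, x <= 0 -> s x = 0) /\ (forall x, 1 <= x -> s x = 1).
Proof.
  set (bump := fun x => flat 0 x * flat 0 ((-1) * x + 1)).
  assert (Hs : smooth bump).
  { apply smooth_mult; [apply smooth_flat|].
    apply (smooth_scale_arg (-1) (fun x => flat 0 (x + 1))).
    apply smooth_translate, smooth_flat. }
  assert (Hc : forall x, continuous bump x) by (intros; now apply smooth_continuous).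
  assert (Hi : forall u v, ex_RInt bump u v) by (intros; apply (ex_RInt_continuous (V := R_CompleteNormedModule)); auto).
  set (I := RInt bump 0 1).
  assert (HI : 0 < I).
  { apply RInt_gt_0; [lra| |auto].
    intros x Hx. apply Rmult_lt_0_compat; apply flat_gt_0; lra. }
  assert (H0 : forall u v, (forall x, Rmin u v < x < Rmax u v -> bump x = 0) -> RInt bump u v = 0).
  { intros u v H. rewrite (RInt_ext bump (fun _ => 0)) by exact H.
    rewrite RInt_const. unfold scal; simpl; unfold mult; simpl; ring. }
  exists (fun x => / I * RInt bump 0 x). repeat split.
  - apply smooth_scal. apply smooth_primitive with bump; [|exact Hs].
    intros x. apply (is_derive_RInt bump (fun x => RInt bump 0 x) 0 x); [|apply Hc].
    apply filter_forall; intros y. apply (RInt_correct (V := R_CompleteNormedModule)), Hi.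
  - intros x Hx. rewrite H0; [ring|].
    rewrite Rmin_right, Rmax_left by lra. intros y Hy. unfold bump.
    rewrite flat_nonpos; lra.
  - intros x Hx. rewrite <- (RInt_Chasles bump 0 1 x) by apply Hi.
    rewrite (H0 1 x).
    + unfold plus; simpl. fold I. field; lra.
    + rewrite Rmin_left, Rmax_right by lra. intros y Hy. unfold bump.
      rewrite (flat_nonpos 0 (-1 * y + 1)); lra.
Qed.

Lemma continuous_bounded_on (f : R -> R) (u v : R) :
  (forall x, continuous f x) -> exists A, 0 <= A /\ forall x, u <= x <= v -> Rabs (f x) <= A.
Proof.
  intros Hf. destruct (Rle_lt_dec u v) as [H|H]; [|exists 0; split; intros; lra].
  destruct (continuity_ab_maj (fun x => Rabs (f x)) u v H) as [m [Hm _]].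
  - intros c _. apply continuity_pt_filterlim.
    apply (continuous_comp f Rabs); [apply Hf|apply continuous_Rabs].
  - exists (Rabs (f m)); split; [apply Rabs_pos|exact Hm].
Qed.

(** Such functions multiply the Schwartz space into itself. A common constant for all orders up to n
    is the form that the product estimate consumes. *)
Definition derivs_bounded (f : R -> R) : Prop :=
  forall n : nat, exists A, 0 <= A /\ forall i x, (i <= n)%nat -> Rabs (Derive_n f i x) <= A.

Lemma derivs_boundedI (f : R -> R) :
  (forall i, exists A, forall x, Rabs (Derive_n f i x) <= A) -> derivs_bounded f.
Proof.
  intros H n. induction n as [|n [A [HA IH]]].
  - destruct (H 0%nat) as [A HA]. exists A; split.
    + eapply Rle_trans; [apply Rabs_pos|apply (HA 0)].
    + intros i x Hi. now replace i with 0%nat by lia.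
  - destruct (H (S n)) as [B HB]. exists (Rmax A B); split.
    + eapply Rle_trans; [exact HA|apply Rmax_l].
    + intros i x Hi. destruct (Nat.eq_dec i (S n)) as [->|Hne].
      * eapply Rle_trans; [apply HB|apply Rmax_r].
      * eapply Rle_trans; [apply IH; lia|apply Rmax_l].
Qed.

(** Compactness handles [u, v]; elsewhere f is locally constant, so only order 0 contributes, namely
    |c| or |d|. *)
Lemma derivs_bounded_of_eventually_const (f : R -> R) (u v c d : R) : smooth f ->
  (forall x, x <= u -> f x = c) -> (forall x, v <= x -> f x = d) -> derivs_bounded f.
Proof.
  intros Hf Hu Hv. apply derivs_boundedI. intros i.
  destruct (continuous_bounded_on (Derive_n f i) u v) as [A [HA H]].
  { intros; now apply smooth_Derive_n_continuous. }
  assert (Hk : forall k x r, 0 < r -> (forall y, Rabs (y - x) < r -> f y = k) ->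
               Rabs (Derive_n f i x) <= Rabs k).
  { intros k x r Hr Hy. rewrite (Derive_n_ext_loc f (fun _ => k) i x).
    - destruct i; [apply Rle_refl|]. rewrite Derive_n_const, Rabs_R0. apply Rabs_pos.
    - exists (mkposreal r Hr). intros y By. apply Hy. exact By. }
  exists (A + Rabs c + Rabs d). intros x.
  pose proof (Rabs_pos c); pose proof (Rabs_pos d).
  destruct (Rlt_le_dec x u) as [Hx|Hx].
  - enough (Rabs (Derive_n f i x) <= Rabs c) by lra.
    apply Hk with (u - x); [lra|]. intros y Hy. apply Rabs_def2 in Hy. apply Hu; lra.
  - destruct (Rlt_le_dec v x) as [Hx'|Hx'].
    + enough (Rabs (Derive_n f i x) <= Rabs d) by lra.
      apply Hk with (x - v); [lra|]. intros y Hy. apply Rabs_def2 in Hy. apply Hv; lra.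
    + specialize (H x). lra.
Qed.

(** * Uniform boundedness on the Schwartz space *)

Definition rschwartz (f : R -> R) : Prop :=
  smooth f /\ forall k m : nat, exists M : R, forall x : R, Rabs x ^ k * Rabs (Derive_n f m x) <= M.

Definition seminorms_le (N : nat) (M : R) (f : R -> R) : Prop :=
  forall (x : R) (k m : nat), (k <= N)%nat -> (m <= N)%nat ->
    Rabs x ^ k * Rabs (Derive_n f m x) <= M.

Lemma abs_pow_ge_0 (x : R) (k : nat) : 0 <= Rabs x ^ k.
Proof. apply pow_le, Rabs_pos. Qed.

Lemma seminorms_le_weaken (N N' : nat) (M M' : R) (f : R -> R) :
  (N' <= N)%nat -> M <= M' -> seminorms_le N M f -> seminorms_le N' M' f.
Proof.
  intros HN HM H x k m Hk Hm. eapply Rle_trans; [apply H; lia|exact HM].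
Qed.

Lemma seminorms_le_plus (N : nat) (M M' : R) (f h : R -> R) : smooth f -> smooth h ->
  seminorms_le N M f -> seminorms_le N M' h -> seminorms_le N (M + M') (fun x => f x + h x).
Proof.
  intros Sf Sh Hf Hh x k m Hk Hm. rewrite Derive_n_smooth_plus by assumption.
  specialize (Hf x k m Hk Hm). specialize (Hh x k m Hk Hm).
  pose proof (Rmult_le_compat_l _ _ _ (abs_pow_ge_0 x k)
                (Rabs_triang (Derive_n f m x) (Derive_n h m x))).
  lra.
Qed.

Lemma seminorms_le_scal (N : nat) (M c : R) (f : R -> R) :
  seminorms_le N M f -> seminorms_le N (Rabs c * M) (fun x => c * f x).
Proof.
  intros Hf x k m Hk Hm. rewrite Derive_n_scal_l, Rabs_mult.
  replace (Rabs x ^ k * (Rabs c * Rabs (Derive_n f m x)))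
    with (Rabs c * (Rabs x ^ k * Rabs (Derive_n f m x))) by ring.
  apply Rmult_le_compat_l; [apply Rabs_pos|now apply Hf].
Qed.

Lemma minus_eq_scal (f h : R -> R) : (fun x => f x - h x) = (fun x => f x + (-1) * h x).
Proof. extensionality x; ring. Qed.

Lemma rschwartz_seminorms (N : nat) (f : R -> R) : rschwartz f ->
  exists M, 0 <= M /\ seminorms_le N M f.
Proof.
  intros [_ Hf].
  enough (H : forall K L, exists M, 0 <= M /\ forall x k m, (k <= K)%nat -> (m <= L)%nat ->
                Rabs x ^ k * Rabs (Derive_n f m x) <= M) by (destruct (H N N) as [M HM]; exists M; exact HM).
  assert (H1 : forall K m, exists M, 0 <= M /\ forall x k, (k <= K)%nat ->
                Rabs x ^ k * Rabs (Derive_n f m x) <= M).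
  { intros K m. induction K as [|K [A [HA IH]]].
    - destruct (Hf 0%nat m) as [A HA]. exists (Rabs A). split; [apply Rabs_pos|].
      intros x k Hk. replace k with 0%nat by lia.
      eapply Rle_trans; [apply HA|apply Rle_abs].
    - destruct (Hf (S K) m) as [B HB]. exists (Rmax A B). split.
      + eapply Rle_trans; [exact HA|apply Rmax_l].
      + intros x k Hk. destruct (Nat.eq_dec k (S K)) as [->|Hne].
        * eapply Rle_trans; [apply HB|apply Rmax_r].
        * eapply Rle_trans; [apply IH; lia|apply Rmax_l]. }
  intros K L. induction L as [|L [A [HA IH]]].
  - destruct (H1 K 0%nat) as [A [HA H]]. exists A. split; [exact HA|].
    intros x k m Hk Hm. replace m with 0%nat by lia. now apply H.
  - destruct (H1 K (S L)) as [B [HB H]]. exists (Rmax A B). split.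
    + eapply Rle_trans; [exact HA|apply Rmax_l].
    + intros x k m Hk Hm. destruct (Nat.eq_dec m (S L)) as [->|Hne].
      * eapply Rle_trans; [now apply H|apply Rmax_r].
      * eapply Rle_trans; [apply IH; lia|apply Rmax_l].
Qed.

Lemma rschwartz_plus (f h : R -> R) :
  rschwartz f -> rschwartz h -> rschwartz (fun x => f x + h x).
Proof.
  intros Hf Hh. split; [apply smooth_plus; [apply Hf|apply Hh]|].
  intros k m.
  destruct (rschwartz_seminorms (k + m) f Hf) as [A [_ HA]].
  destruct (rschwartz_seminorms (k + m) h Hh) as [B [_ HB]].
  exists (A + B). intros x.
  apply (seminorms_le_plus (k + m) A B f h); try assumption; [apply Hf|apply Hh|lia|lia].
Qed.

Lemma rschwartz_scal (c : R) (f : R -> R) : rschwartz f -> rschwartz (fun x => c * f x).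
Proof.
  intros Hf. split; [apply smooth_scal, Hf|].
  intros k m. destruct (rschwartz_seminorms (k + m) f Hf) as [A [_ HA]].
  exists (Rabs c * A). intros x. apply (seminorms_le_scal (k + m) A c f HA); lia.
Qed.

Lemma rschwartz_minus (f h : R -> R) :
  rschwartz f -> rschwartz h -> rschwartz (fun x => f x - h x).
Proof.
  intros Hf Hh. rewrite minus_eq_scal. now apply rschwartz_plus, rschwartz_scal.
Qed.

Lemma rschwartz_zero : rschwartz (fun _ => 0).
Proof.
  split; [apply smooth_const|]. intros k m. exists 0. intros x.
  rewrite Derive_n_zero, Rabs_R0; lra.
Qed.

Lemma seminorms_le_zero (N : nat) : seminorms_le N 0 (fun _ => 0).
Proof. intros x k m _ _. rewrite Derive_n_zero, Rabs_R0; lra. Qed.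

Lemma rschwartz_mult (u f : R -> R) : smooth u -> derivs_bounded u -> rschwartz f ->
  rschwartz (fun x => u x * f x).
Proof.
  intros Su Bu Hf. split; [apply smooth_mult; [exact Su|apply Hf]|].
  intros k m. destruct (Bu m) as [A [HA HuA]].
  destruct (rschwartz_seminorms (k + m) f Hf) as [M [HM HfM]].
  destruct (rschwartz_seminorms m f Hf) as [M0 [HM0 HfM0]].
  exists (2 ^ m * (A * M)). intros x.
  assert (Hp : forall B, (forall i, (i <= m)%nat -> Rabs (Derive_n f i x) <= B) ->
     Rabs (Derive_n (fun x => u x * f x) m x) <= 2 ^ m * (A * B)).
  { intros B HB. apply Derive_n_mult_bound; auto. apply Hf. }
  (* Where |x|^k is nonzero, the seminorm of f reads |f^(i)(x)| <= M / |x|^k, and this pointwise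
     bound goes into the product estimate. *)
  destruct (Req_dec (Rabs x ^ k) 0) as [E|E].
  - rewrite E, Rmult_0_l. apply Rmult_le_pos; [apply pow_le; lra|now apply Rmult_le_pos].
  - assert (Hpos : 0 < Rabs x ^ k) by (pose proof (abs_pow_ge_0 x k); lra).
    replace (2 ^ m * (A * M)) with (Rabs x ^ k * (2 ^ m * (A * (M / Rabs x ^ k)))) by (field; lra).
    apply Rmult_le_compat_l; [lra|]. apply Hp. intros i Hi.
    apply Rmult_le_reg_l with (Rabs x ^ k); [exact Hpos|].
    replace (Rabs x ^ k * (M / Rabs x ^ k)) with M by (field; lra).
    apply HfM; lia.
Qed.

(** Completeness of S(R) in the shape that nested balls produce: the orders [N n] grow, so each
    fixed seminorm is eventually controlled. All derivatives converge uniformly, and their limits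
    form a tower of derivatives. *)
Lemma rschwartz_complete (f : nat -> R -> R) (N : nat -> nat) (d : nat -> R) :
  (forall n, rschwartz (f n)) ->
  (forall n, (n <= N n)%nat) ->
  (forall eps, 0 < eps -> exists n0, forall n, (n0 <= n)%nat -> d n < eps) ->
  (forall n j, (n <= j)%nat -> seminorms_le (N n) (d n) (fun x => f j x - f n x)) ->
  exists z, rschwartz z /\ forall n, seminorms_le (N n) (d n) (fun x => z x - f n x).
Proof.
  intros Hf HN Hd Hc.
  set (h := fun m t => real (Lim_seq (fun n => Derive_n (f n) m t))).
  assert (Hc' : forall n j m k x, (n <= j)%nat -> (m <= N n)%nat -> (k <= N n)%nat ->
            Rabs x ^ k * Rabs (Derive_n (f j) m x - Derive_n (f n) m x) <= d n).
  { intros n j m k x Hnj Hm Hk.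
    rewrite <- (Derive_n_smooth_minus _ _ _ _ (proj1 (Hf j)) (proj1 (Hf n))). now apply (Hc n j Hnj). }
  assert (HU : forall m, CVU_dom (fun n => Derive_n (f n) m) (fun _ => True)).
  { intros m. apply CVU_dom_cauchy. intros eps.
    assert (He : 0 < eps / 2) by (destruct eps; simpl; lra).
    destruct (Hd (eps / 2) He) as [n0 Hn0].
    (* Adding m makes the order at this index at least m, so that the m-th derivative is among those
       compared. *)
    exists (n0 + m)%nat. intros n j x _ Hn Hj.
    set (p := (n0 + m)%nat).
    assert (Hp : (m <= N p)%nat) by (specialize (HN p); unfold p in *; lia).
    pose proof (Hc' p n m 0%nat x Hn Hp ltac:(lia)) as H1.
    pose proof (Hc' p j m 0%nat x Hj Hp ltac:(lia)) as H2.
    simpl in H1, H2. rewrite Rmult_1_l in H1, H2.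
    specialize (Hn0 p ltac:(unfold p; lia)).
    replace (Derive_n (f n) m x - Derive_n (f j) m x) with
      ((Derive_n (f n) m x - Derive_n (f p) m x) - (Derive_n (f j) m x - Derive_n (f p) m x)) by ring.
    eapply Rle_lt_trans; [apply Rabs_triang|]. rewrite Rabs_Ropp. lra. }
  assert (HL : forall m x, is_lim_seq (fun n => Derive_n (f n) m x) (h m x)).
  { intros m x. destruct (CVU_CVS_dom _ _ (HU m) x I) as [l Hl].
    unfold h. now rewrite (is_lim_seq_unique _ _ Hl). }
  assert (HD : forall m x, is_derive (h m) x (h (S m) x)).
  { intros m x.
    apply (CVU_Derive (fun n => Derive_n (f n) m) (fun _ => True)); auto.
    - apply open_true.
    - intros u v t _ _ _ ; exact I.
    - intros n y _. exact (proj1 (Hf n) (S m) y).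
    - intros n y _. apply continuity_pt_filterlim.
      apply (smooth_Derive_n_continuous (f n) (S m)), Hf.
    - exact (HU (S m)). }
  destruct (smooth_of_tower h HD) as [Sh Dh].
  (* The index j goes to infinity in [Hc']. *)
  assert (Hz : forall n, seminorms_le (N n) (d n) (fun x => h 0%nat x - f n x)).
  { intros n x k m Hk Hm. rewrite (Derive_n_smooth_minus _ _ _ _ Sh (proj1 (Hf n))).
    rewrite Dh.
    apply (is_lim_seq_le_loc
      (fun j => Rabs x ^ k * Rabs (Derive_n (f j) m x - Derive_n (f n) m x)) (fun _ => d n)
      (Finite (Rabs x ^ k * Rabs (h m x - Derive_n (f n) m x))) (Finite (d n))).
    - exists n. intros j Hj. now apply Hc'.
    - apply (is_lim_seq_scal_l _ (Rabs x ^ k) (Finite (Rabs (h m x - Derive_n (f n) m x)))).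
      apply (is_lim_seq_abs _ (Finite (h m x - Derive_n (f n) m x))).
      apply is_lim_seq_minus'; [apply HL|apply is_lim_seq_const].
    - apply is_lim_seq_const. }
  exists (h 0%nat). split; [|exact Hz].
  split; [exact Sh|]. intros k m.
  set (n := (k + m)%nat). pose proof (HN n) as Hn.
  destruct (proj2 (Hf n) k m) as [M HM].
  exists (d n + M). intros x.
  specialize (Hz n x k m ltac:(unfold n in *; lia) ltac:(unfold n in *; lia)).
  rewrite (Derive_n_smooth_minus _ _ _ _ Sh (proj1 (Hf n))) in Hz.
  specialize (HM x).
  replace (Derive_n (h 0%nat) m x) with
    ((Derive_n (h 0%nat) m x - Derive_n (f n) m x) + Derive_n (f n) m x) by ring.
  pose proof (Rmult_le_compat_l _ _ _ (abs_pow_ge_0 x k)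
    (Rabs_triang (Derive_n (h 0%nat) m x - Derive_n (f n) m x) (Derive_n (f n) m x))).
  lra.
Qed.

(** A closed ball for the seminorms up to a given order. The topology of S(R) is not given by one
    norm, so a shrinking sequence of balls must also increase the order. *)
Record sball : Type := Sball {
  center : R -> R;
  center_schwartz : rschwartz center;
  order : nat;
  radius : R;
  radius_pos : 0 < radius }.

Definition in_sball (B : sball) (f : R -> R) : Prop :=
  seminorms_le (order B) (radius B) (fun x => f x - center B x).

(* The Banach-Steinhaus theorem on S(R), by nested balls: if the conclusion failed, every ball
   would contain a smaller one on which some late member of the family is large. *)
Lemma schwartz_uniform_boundedness (q : R -> (R -> R) -> R) :
  (forall lam f h, 1 <= lam -> rschwartz f -> rschwartz h ->
     q lam (fun x => f x + h x) <= q lam f + q lam h) ->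
  (forall lam c f, 1 <= lam -> rschwartz f -> q lam (fun x => c * f x) = Rabs c * q lam f) ->
  (forall lam, 1 <= lam -> exists (K : R) (N : nat), 0 <= K /\
     forall f M, rschwartz f -> seminorms_le N M f -> q lam f <= K * M) ->
  (forall f, rschwartz f -> exists K L0, forall lam, L0 <= lam -> q lam f <= K) ->
  exists (K : R) (N : nat) (L0 : R), 0 <= K /\ 1 <= L0 /\
    forall lam f M, L0 <= lam -> rschwartz f -> 0 < M -> seminorms_le N M f -> q lam f <= K * M.
Proof.
  intros Hadd Hscal Hcont Hbd. apply NNPP. intros Hno.
  assert (Hstep : forall (n : nat) (B : sball), exists B' : sball,
     ((S n <= order B')%nat /\ (order B <= order B')%nat /\
      radius B' <= radius B / 2 /\
      seminorms_le (order B) (radius B / 2) (fun x => center B' x - center B x)) /\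
     exists lam, INR n <= lam /\ forall f, rschwartz f -> in_sball B' f -> INR n <= q lam f).
  { intros n [c Hc N d Hd]. simpl.
    assert (Hn := pos_INR n).
    assert (H : exists lam f M, Rmax (INR n) 1 <= lam /\ rschwartz f /\ 0 < M /\
                  seminorms_le N M f /\ 2 * (INR n + 1) / d * M < q lam f).
    { apply NNPP. intros H. apply Hno.
      exists (2 * (INR n + 1) / d), N, (Rmax (INR n) 1). repeat split.
      - apply Rmult_le_pos; [lra|]. left; now apply Rinv_0_lt_compat.
      - apply Rmax_r.
      - intros lam f M Hl Hf HM Hs. apply Rnot_lt_le. intros Hlt. apply H.
        now exists lam, f, M. }
    destruct H as (lam & f & M & Hl & Hf & HM & Hs & Hq).
    assert (Hl1 : 1 <= lam) by (eapply Rle_trans; [apply Rmax_r|exact Hl]).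
    assert (Hln : INR n <= lam) by (eapply Rle_trans; [apply Rmax_l|exact Hl]).
    (* With this scale, t f and -t f have seminorms at most d/2, whereas the value of [q lam] at 2 t
       f exceeds 2 (n + 1). *)
    set (t := d / (2 * M)).
    assert (Ht : 0 < t) by (apply Rdiv_lt_0_compat; lra).
    assert (Hx : forall s, Rabs s = 1 -> rschwartz (fun x => s * t * f x) /\
                seminorms_le N (d / 2) (fun x => s * t * f x)).
    { intros s Hs1. split; [now apply rschwartz_scal|].
      replace (d / 2) with (Rabs (s * t) * M).
      - now apply seminorms_le_scal.
      - rewrite Rabs_mult, Hs1, (Rabs_pos_eq t) by lra. unfold t. field. lra. }
    assert (A1 : Rabs 1 = 1) by apply Rabs_R1.
    assert (A2 : Rabs (-1) = 1) by (rewrite Rabs_left; lra).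
    (* Since 2 t f = (c + t f) - (c - t f), subadditivity forces one of the two signs to give at
       least n + 1. *)
    assert (Hc' : exists s, Rabs s = 1 /\ INR n + 1 <= q lam (fun x => c x + s * t * f x)).
    { apply NNPP. intros H.
      assert (B : forall s, Rabs s = 1 -> q lam (fun x => c x + s * t * f x) < INR n + 1).
      { intros s E. apply Rnot_le_lt. intros Hle. apply H. now exists s. }
      pose proof (B 1 A1) as B1. pose proof (B (-1) A2) as B2.
      assert (E : (fun x => 2 * t * f x) =
        (fun x => (c x + 1 * t * f x) + (-1) * (c x + (-1) * t * f x)))
        by (extensionality x; ring).
      assert (S1 : rschwartz (fun x => c x + 1 * t * f x)) by now apply rschwartz_plus, Hx.
      assert (S2 : rschwartz (fun x => c x + (-1) * t * f x)) by now apply rschwartz_plus, Hx.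
      pose proof (Hscal lam (2 * t) f Hl1 Hf) as E2.
      rewrite E in E2.
      pose proof (Hadd lam _ (fun x => (-1) * (c x + (-1) * t * f x)) Hl1 S1
                    (rschwartz_scal _ _ S2)) as E3.
      cbv beta in E3.
      rewrite E2, Hscal, A2, Rabs_pos_eq in E3 by (assumption || lra).
      assert (E4 : 2 * t * (2 * (INR n + 1) / d * M) < 2 * t * q lam f)
        by (apply Rmult_lt_compat_l; lra).
      replace (2 * t * (2 * (INR n + 1) / d * M)) with (2 * (INR n + 1)) in E4
        by (unfold t; field; lra).
      lra. }
    destruct Hc' as (s & As & Hqs).
    destruct (Hx s As) as [Sx Bx].
    destruct (Hcont lam Hl1) as (K & N' & HK & HKN).
    assert (Sc : rschwartz (fun x => c x + s * t * f x)) by now apply rschwartz_plus.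
    (* The first bound halves the radius; the second lets [q lam] drop by at most 1 on the new ball,
       from n + 1 to n. *)
    set (r := Rmin (d / 2) (/ (K + 1))).
    assert (Hr : 0 < r).
    { unfold r; apply Rmin_glb_lt; [lra|apply Rinv_0_lt_compat; lra]. }
    (* The new order passes n, includes the old order N, and includes the order N' in which this
       [q lam] is continuous. *)
    exists (Sball _ Sc (S n + N + N') r Hr). simpl.
    split; [repeat split|].
    - lia.
    - lia.
    - apply Rmin_l.
    - replace (fun x => c x + s * t * f x - c x) with (fun x => s * t * f x)
        by (extensionality x; ring). exact Bx.
    - exists lam. split; [exact Hln|]. intros z Hz Hin. unfold in_sball in Hin. simpl in Hin.
      set (w := fun x => c x + s * t * f x) in *.
      assert (E : w = (fun x => z x + (-1) * (z x - w x))) by (extensionality x; ring).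
      assert (Sd : rschwartz (fun x => z x - w x)) by now apply rschwartz_minus.
      pose proof (Hadd lam z (fun x => (-1) * (z x - w x)) Hl1 Hz (rschwartz_scal _ _ Sd)) as E3.
      cbv beta in E3.
      rewrite <- E, Hscal, A2, Rmult_1_l in E3 by assumption.
      assert (E4 : q lam (fun x => z x - w x) <= K * r).
      { apply HKN; [exact Sd|]. apply seminorms_le_weaken with (3 := Hin); [lia|lra]. }
      assert (E5 : K * r <= 1).
      { apply Rle_trans with (K * / (K + 1)).
        - apply Rmult_le_compat_l; [exact HK|apply Rmin_r].
        - apply Rmult_le_reg_r with (K + 1); [lra|].
          rewrite Rmult_assoc, Rinv_l by lra. lra. }
      lra. }
  set (next := fun n B => proj1_sig (constructive_indefinite_description _ (Hstep n B))).
  assert (Hnext := fun n B => proj2_sig (constructive_indefinite_description _ (Hstep n B))).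
  set (B := fix B n := match n with
    | O => Sball (fun _ => 0) rschwartz_zero 0 1 Rlt_0_1
    | S n => next n (B n) end).
  assert (HB : forall n, (n <= order (B n))%nat).
  { intros [|n]; [lia|]. apply (Hnext n (B n)). }
  assert (Hr : forall n, radius (B n) <= (/ 2) ^ n).
  { intros n; induction n as [|n IH]; [simpl; lra|].
    destruct (Hnext n (B n)) as [(_ & _ & H & _) _]. fold (next n (B n)) in H.
    simpl B. simpl pow. lra. }
  (* Each centre moves by at most half the radius, and the radius shrinks by at least as much; the
     distances therefore telescope against the loss of radius. *)
  assert (Hdist : forall n k, (order (B n) <= order (B (n + k)))%nat /\
            seminorms_le (order (B n)) (radius (B n) - radius (B (n + k)%nat))
              (fun x => center (B (n + k)%nat) x - center (B n) x)).
  { intros n k; induction k as [|k [IH1 IH2]].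
    - rewrite Nat.add_0_r. split; [lia|].
      replace (radius (B n) - radius (B n)) with 0 by ring.
      replace (fun x => center (B n) x - center (B n) x) with (fun _ : R => 0)
        by (extensionality x; ring).
      apply seminorms_le_zero.
    - rewrite Nat.add_succ_r.
      destruct (Hnext (n + k)%nat (B (n + k)%nat)) as [(_ & H1 & H2 & H3) _].
      fold (next (n + k)%nat (B (n + k)%nat)) in H1, H2, H3.
      change (next (n + k)%nat (B (n + k)%nat)) with (B (S (n + k))) in H1, H2, H3.
      split; [lia|].
      apply seminorms_le_weaken with (order (B n))
        ((radius (B n) - radius (B (n + k)%nat)) + radius (B (n + k)%nat) / 2); [lia|lra|].
      replace (fun x => center (B (S (n + k))) x - center (B n) x) with
        (fun x => (center (B (n + k)%nat) x - center (B n) x) +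
                  (center (B (S (n + k))) x - center (B (n + k)%nat) x))
        by (extensionality x; ring).
      apply seminorms_le_plus; try exact IH2;
        try (apply smooth_minus; apply center_schwartz).
      apply seminorms_le_weaken with (3 := H3); [lia|lra]. }
  destruct (rschwartz_complete (fun n => center (B n)) (fun n => order (B n)) (fun n => radius (B n)))
    as [z [Hz Hin]].
  - intros n; apply center_schwartz.
  - exact HB.
  - intros eps Heps.
    destruct (pow_lt_1_zero (/ 2)) with eps as [n0 Hn0]; [rewrite Rabs_pos_eq; lra|exact Heps|].
    exists n0. intros n Hn. specialize (Hn0 n Hn). specialize (Hr n).
    pose proof (Rle_abs ((/ 2) ^ n)). lra.
  - intros n j Hj. replace j with (n + (j - n))%nat by lia.
    apply seminorms_le_weaken with (3 := proj2 (Hdist n (j - n)%nat)); [lia|].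
    pose proof (radius_pos (B (n + (j - n))%nat)). lra.
  - destruct (Hbd z Hz) as (K & L0 & HK).
    (* The limit z lies in every ball, so for n above both K and L0 some lam >= n gives a value at
       least n > K, against the pointwise bound. *)
    destruct (INR_unbounded (Rmax K L0)) as [n Hn].
    destruct (Hnext n (B n)) as [_ (lam & Hl & Hq)].
    fold (next n (B n)) in Hq. change (next n (B n)) with (B (S n)) in Hq.
    specialize (Hq z Hz (Hin (S n))).
    pose proof (Rmax_l K L0). pose proof (Rmax_r K L0).
    specialize (HK lam ltac:(lra)). lra.
Qed.

(** * Density of exponential sums *)

(* Expectation of [phi] under the binomial law with parameters [n] and [x], so that the Bernstein
   polynomial of [H] is [bernstein n (fun k => H (k / n)) x]. *)
Fixpoint bernstein (n : nat) (phi : nat -> R) (x : R) : R :=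
  match n with
  | O => phi 0%nat
  | S n => x * bernstein n (fun k => phi (S k)) x + (1 - x) * bernstein n phi x
  end.

Lemma bernstein_le (n : nat) (x : R) : 0 <= x <= 1 -> forall phi psi : nat -> R,
  (forall k, (k <= n)%nat -> phi k <= psi k) -> bernstein n phi x <= bernstein n psi x.
Proof.
  intros Hx. induction n as [|n IH]; intros phi psi H; simpl.
  - apply H; lia.
  - apply Rplus_le_compat; apply Rmult_le_compat_l; try lra; apply IH; intros; apply H; lia.
Qed.

Lemma bernstein_affine (n : nat) (x c d : R) : forall phi : nat -> R,
  bernstein n (fun k => c * phi k + d) x = c * bernstein n phi x + d.
Proof.
  induction n as [|n IH]; intros phi; simpl; [reflexivity|].
  rewrite (IH phi), (IH (fun k => phi (S k))). ring.
Qed.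

(** Variance plus squared bias of the binomial law. The centre c is arbitrary because conditioning
    on one trial shifts it by 1; the case used is c = n x. *)
Lemma bernstein_second_moment (n : nat) (x : R) : forall c : R,
  bernstein n (fun k => (INR k - c) ^ 2) x = INR n * (x * (1 - x)) + (INR n * x - c) ^ 2.
Proof.
  induction n as [|n IH]; intros c; [simpl; ring|].
  change (bernstein (S n) (fun k => (INR k - c) ^ 2) x) with
    (x * bernstein n (fun k => (INR (S k) - c) ^ 2) x
     + (1 - x) * bernstein n (fun k => (INR k - c) ^ 2) x).
  replace (fun k => (INR (S k) - c) ^ 2) with (fun k => (INR k - (c - 1)) ^ 2).
  2: { extensionality k. rewrite S_INR. ring. }
  rewrite !IH, S_INR. ring.
Qed.

(** Bernstein's proof by Chebyshev's inequality: |H(x) - H(k/n)| is at most eps/2 plus a multiple of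
    (x - k/n)^2, and the expectation of the latter is of order 1/n. *)
Lemma bernstein_approx (H : R -> R) (eps : R) : (forall x, continuous H x) -> 0 < eps ->
  exists n phi, forall x, 0 <= x <= 1 -> Rabs (H x - bernstein n phi x) <= eps.
Proof.
  intros Hc Heps.
  destruct (continuous_bounded_on H 0 1 Hc) as [A [HA HbA]].
  assert (He2 : 0 < eps / 2) by lra.
  destruct (@Heine_cor2 H 0 1 (fun x _ => proj2 (continuity_pt_filterlim H x) (Hc x))
              (mkposreal _ He2)) as [[d Hd] Hu].
  simpl in Hu.
  assert (Hd2 : 0 < d ^ 2) by now apply pow_lt.
  (* Chosen so that c d^2 = 2 A bounds the oscillation of H when k/n is at distance d or more from
     x. *)
  set (c := 2 * A / d ^ 2).
  assert (Hc0 : 0 <= c) by (apply Rdiv_le_0_compat; lra).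
  destruct (INR_unbounded (c / (eps / 2))) as [n0 Hn0].
  set (n := S n0).
  assert (Hn : 0 < INR n) by (apply lt_0_INR; unfold n; lia).
  assert (Hcn : c / INR n <= eps / 2).
  { apply Rmult_le_reg_r with (INR n); [exact Hn|].
    replace (c / INR n * INR n) with (c / (eps / 2) * (eps / 2)) by (field; lra).
    rewrite (Rmult_comm (eps / 2)). apply Rmult_le_compat_r; [lra|].
    unfold n. rewrite S_INR. lra. }
  set (phi := fun k => H (INR k / INR n)).
  exists n, phi. intros x Hx.
  assert (Hk : forall k, (k <= n)%nat -> Rabs (H x - phi k) <=
             c / INR n ^ 2 * (INR k - INR n * x) ^ 2 + eps / 2).
  { intros k Hkn.
    assert (Hk01 : 0 <= INR k / INR n <= 1).
    { split; [apply Rdiv_le_0_compat; [apply pos_INR|exact Hn]|].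
      apply Rmult_le_reg_r with (INR n); [exact Hn|].
      unfold Rdiv; rewrite Rmult_assoc, Rinv_l, Rmult_1_r, Rmult_1_l by lra.
      now apply le_INR. }
    replace (c / INR n ^ 2 * (INR k - INR n * x) ^ 2) with (c * (x - INR k / INR n) ^ 2)
      by (field; lra).
    destruct (Rlt_le_dec (Rabs (x - INR k / INR n)) d) as [Hlt|Hge].
    - specialize (Hu x (INR k / INR n) Hx Hk01 Hlt).
      assert (0 <= c * (x - INR k / INR n) ^ 2)
        by (apply Rmult_le_pos; [exact Hc0|apply pow2_ge_0]).
      unfold phi. lra.
    - assert (Hsq : d ^ 2 <= (x - INR k / INR n) ^ 2).
      { rewrite <- (pow2_abs (x - _)). apply pow_incr. lra. }
      apply Rle_trans with (2 * A).
      + eapply Rle_trans; [apply Rabs_triang|]. rewrite Rabs_Ropp.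
        pose proof (HbA x Hx). pose proof (HbA _ Hk01). unfold phi. lra.
      + apply Rle_trans with (c * d ^ 2); [unfold c; right; field; lra|].
        pose proof (Rmult_le_compat_l c _ _ Hc0 Hsq). lra. }
  assert (HE : bernstein n (fun k => c / INR n ^ 2 * (INR k - INR n * x) ^ 2 + eps / 2) x <= eps).
  { rewrite (bernstein_affine n x (c / INR n ^ 2) (eps / 2)).
    rewrite bernstein_second_moment.
    replace (c / INR n ^ 2 * (INR n * (x * (1 - x)) + (INR n * x - INR n * x) ^ 2) + eps / 2)
      with (c / INR n * (x * (1 - x)) + eps / 2) by (field; lra).
    assert (0 <= x * (1 - x) <= 1) by nra.
    assert (0 <= c / INR n) by (apply Rdiv_le_0_compat; lra).
    nra. }
  apply Rabs_le. split.
  - assert (B : bernstein n phi x <=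
      bernstein n (fun k => 1 * (c / INR n ^ 2 * (INR k - INR n * x) ^ 2 + eps / 2) + H x) x).
    { apply bernstein_le; [exact Hx|]. intros k Hkn. specialize (Hk k Hkn).
      apply Rabs_le_between in Hk. lra. }
    rewrite bernstein_affine in B. lra.
  - assert (B : bernstein n (fun k => (-1) * (c / INR n ^ 2 * (INR k - INR n * x) ^ 2 + eps / 2)
                  + H x) x <= bernstein n phi x).
    { apply bernstein_le; [exact Hx|]. intros k Hkn. specialize (Hk k Hkn).
      apply Rabs_le_between in Hk. lra. }
    rewrite bernstein_affine in B. lra.
Qed.

(** * Sums of decaying exponentials *)

Inductive exp_span : (R -> R) -> Prop :=
| exp_span_0 : exp_span (fun _ => 0)
| exp_span_add (c y : R) (f : R -> R) : 0 < y -> exp_span f ->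
    exp_span (fun x => c * exp (- (y * x)) + f x).

Lemma exp_span_exp (c y : R) : 0 < y -> exp_span (fun x => c * exp (- (y * x))).
Proof.
  intros Hy. replace (fun x => c * exp (- (y * x))) with (fun x => c * exp (- (y * x)) + 0)
    by (extensionality x; ring).
  apply exp_span_add; [exact Hy|apply exp_span_0].
Qed.

Lemma exp_span_plus (f h : R -> R) : exp_span f -> exp_span h -> exp_span (fun x => f x + h x).
Proof.
  intros Hf Hh. induction Hf as [|c y f Hy Hf IH].
  - now replace (fun x => 0 + h x) with h by (extensionality x; ring).
  - replace (fun x => c * exp (- (y * x)) + f x + h x)
      with (fun x => c * exp (- (y * x)) + (f x + h x)) by (extensionality x; ring).
    now apply exp_span_add.
Qed.

Lemma exp_span_mult_exp (d z : R) (f : R -> R) : 0 <= z -> exp_span f ->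
  exp_span (fun x => d * exp (- (z * x)) * f x).
Proof.
  intros Hz Hf. induction Hf as [|c y f Hy Hf IH].
  - replace (fun x => d * exp (- (z * x)) * 0) with (fun _ : R => 0) by (extensionality x; ring).
    apply exp_span_0.
  - replace (fun x => d * exp (- (z * x)) * (c * exp (- (y * x)) + f x))
      with (fun x => (d * c) * exp (- ((z + y) * x)) + d * exp (- (z * x)) * f x).
    + apply exp_span_add; [lra|exact IH].
    + extensionality x.
      replace (- ((z + y) * x)) with (- (z * x) + - (y * x)) by ring. rewrite exp_plus. ring.
Qed.

(** All exponents are strictly positive, so termwise integration stays in the span; without a
    constant term, this primitive is the one that vanishes at infinity. *)
Lemma exp_span_primitive (f : R -> R) : exp_span f ->
  exists F, exp_span F /\ forall x, is_derive F x (f x).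
Proof.
  intros Hf. induction Hf as [|c y f Hy Hf [F [HF DF]]].
  - exists (fun _ => 0). split; [apply exp_span_0|].
    intros x. apply (is_derive_const (K := R_AbsRing) (V := R_NormedModule)).
  - exists (fun x => - c / y * exp (- (y * x)) + F x). split; [now apply exp_span_add|].
    intros x. apply (is_derive_plus (K := R_AbsRing) (V := R_NormedModule)); [|apply DF].
    auto_derive; [exact I|]. field. lra.
Qed.

Lemma exp_span_smooth (f : R -> R) : exp_span f -> smooth f.
Proof.
  intros Hf. induction Hf as [|c y f Hy Hf IH]; [apply smooth_const|].
  apply smooth_plus; [apply smooth_scal, smooth_exp_lin|exact IH].
Qed.

Lemma exp_span_decay (f : R -> R) : exp_span f ->
  forall eps, 0 < eps -> exists X, forall x, X <= x -> Rabs (f x) <= eps.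
Proof.
  intros Hf. induction Hf as [|c y f Hy Hf IH]; intros eps Heps.
  - exists 0. intros x _. rewrite Rabs_R0. lra.
  - destruct (IH (eps / 2) ltac:(lra)) as [X HX].
    set (Y := Rabs c / (eps / 2)).
    exists (Rmax X (Y / y)). intros x Hx.
    assert (Hx1 : X <= x) by (eapply Rle_trans; [apply Rmax_l|exact Hx]).
    assert (Hx2 : Y <= y * x).
    { replace Y with (y * (Y / y)) by (field; lra).
      apply Rmult_le_compat_l; [lra|]. eapply Rle_trans; [apply Rmax_r|exact Hx]. }
    eapply Rle_trans; [apply Rabs_triang|].
    replace eps with (eps / 2 + eps / 2) by lra.
    apply Rplus_le_compat; [|now apply HX].
    rewrite Rabs_mult, (Rabs_pos_eq (exp _)) by (left; apply exp_pos).
    rewrite exp_Ropp. pose proof (exp_pos (y * x)).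
    apply Rmult_le_reg_r with (exp (y * x)); [assumption|].
    rewrite Rmult_assoc, Rinv_l, Rmult_1_r by lra.
    pose proof (exp_ineq1_le (y * x)).
    replace (Rabs c) with (eps / 2 * Y) by (unfold Y; field; lra).
    apply Rmult_le_compat_l; lra.
Qed.

(** A polynomial in u = e^{-(x+1)} may have a constant term, which is not in the span; the extra
    factor u removes it. *)
Lemma exp_span_bernstein (n : nat) : forall phi : nat -> R,
  exp_span (fun x => exp (- (x + 1)) * bernstein n phi (exp (- (x + 1)))).
Proof.
  assert (E : forall x, exp (- (x + 1)) = exp (-1) * exp (- (1 * x))).
  { intros x. rewrite <- exp_plus. f_equal. ring. }
  induction n as [|n IH]; intros phi; simpl.
  - replace (fun x => exp (- (x + 1)) * phi 0%nat)
      with (fun x => (exp (-1) * phi 0%nat) * exp (- (1 * x)))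
      by (extensionality x; rewrite E; ring).
    apply exp_span_exp; lra.
  - pose proof (IH (fun k => phi (S k))) as H1. pose proof (IH phi) as H2.
    pose proof (exp_span_mult_exp (exp (-1)) 1 _ ltac:(lra) H1) as H3.
    pose proof (exp_span_mult_exp (- exp (-1)) 1 _ ltac:(lra) H2) as H4.
    pose proof (exp_span_plus _ _ (exp_span_plus _ _ H3 H4) H2) as H5.
    match type of H5 with exp_span ?F => match goal with |- exp_span ?G =>
      replace G with F; [exact H5|] end end.
    extensionality x. rewrite !E. ring.
Qed.

Lemma exp_span_approx_uniform (f : R -> R) (X eps : R) :
  (forall x, continuous f x) -> (forall x, X <= x -> f x = 0) -> 0 < eps ->
  exists psi, exp_span psi /\ forall x, -1 <= x -> Rabs (f x - psi x) <= eps * exp (- x).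
Proof.
  intros Hf HX Heps.
  (* This is f/u in the variable u = e^{-(x+1)}. It is identically 0 below e^{-1-X}, hence
     continuous across 0. An error eps for H becomes u eps <= eps e^{-x} for f. *)
  set (H := fun u => if Rle_dec u 0 then 0 else / u * f (- 1 - ln u)).
  assert (HH : forall u, 0 < u -> H u = / u * f (- 1 - ln u)).
  { intros u Hu. unfold H. destruct (Rle_dec u 0); [lra|reflexivity]. }
  assert (Hsmall : forall u, u < exp (- 1 - X) -> H u = 0).
  { intros u Hu. unfold H. destruct (Rle_dec u 0) as [|Hu0]; [reflexivity|].
    rewrite HX; [ring|]. apply Rnot_le_lt in Hu0.
    apply ln_increasing in Hu; [|exact Hu0]. rewrite ln_exp in Hu. lra. }
  assert (Hc : forall u, continuous H u).
  { intros u. destruct (Rlt_le_dec u (exp (- 1 - X))) as [Hu|Hu].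
    - apply continuous_ext_loc with (fun _ => 0); [|apply continuous_const].
      assert (Hp : 0 < exp (- 1 - X) - u) by lra.
      exists (mkposreal _ Hp). intros v Hv.
      apply Rabs_def2 in Hv; unfold minus, plus, opp in Hv; simpl in Hv.
      symmetry; apply Hsmall; lra.
    - assert (Hp : 0 < u) by (pose proof (exp_pos (- 1 - X)); lra).
      apply continuous_ext_loc with (fun v => / v * f (- 1 - ln v)).
      + exists (mkposreal _ Hp). intros v Hv.
        apply Rabs_def2 in Hv; unfold minus, plus, opp in Hv; simpl in Hv.
        symmetry; apply HH; lra.
      + apply (continuous_mult (fun v => / v) (fun v => f (- 1 - ln v)) u).
        * apply continuous_Rinv; lra.
        * apply (continuous_comp (fun v => - 1 - ln v) f); [|apply Hf].
          apply (ex_derive_continuous (K := R_AbsRing) (V := R_NormedModule)).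
          auto_derive; lra. }
  destruct (bernstein_approx H eps Hc Heps) as (n & phi & Hn).
  exists (fun x => exp (- (x + 1)) * bernstein n phi (exp (- (x + 1)))).
  split; [apply exp_span_bernstein|].
  intros x Hx. set (u := exp (- (x + 1))).
  assert (Hu : 0 < u) by apply exp_pos.
  assert (Hu1 : u <= 1).
  { replace 1 with (exp 0) by apply exp_0.
    destruct (Req_dec x (-1)) as [->|]; [right; unfold u; f_equal; ring|].
    left; apply exp_increasing; lra. }
  specialize (Hn u ltac:(lra)). rewrite HH in Hn by exact Hu.
  replace (- 1 - ln u) with x in Hn by (unfold u; rewrite ln_exp; ring).
  replace (f x - u * bernstein n phi u) with (u * (/ u * f x - bernstein n phi u)) by (field; lra).
  rewrite Rabs_mult, (Rabs_pos_eq u) by lra.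
  apply Rle_trans with (u * eps); [apply Rmult_le_compat_l; lra|].
  rewrite Rmult_comm. apply Rmult_le_compat_l; [lra|].
  unfold u. left; apply exp_increasing; lra.
Qed.

(** Morally r(x) is minus the integral of r' over [x, oo). Without integrals: for s = 1 and s = -1
    the function s r(t) + eps e^{-t} is nonincreasing, and r is arbitrarily small far out. *)
Lemma exp_decay_of_derive (r dr : R -> R) (a eps : R) :
  (forall x, a <= x -> is_derive r x (dr x)) ->
  (forall x, a <= x -> Rabs (dr x) <= eps * exp (- x)) ->
  (forall e, 0 < e -> exists X, forall x, X <= x -> Rabs (r x) <= e) ->
  forall x, a <= x -> Rabs (r x) <= eps * exp (- x).
Proof.
  intros Hr Hdr Hlim x Hx. apply le_epsilon. intros e He.
  destruct (Hlim e He) as [X HX].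
  set (z := Rmax X x + 1).
  assert (Hz : x < z) by (unfold z; pose proof (Rmax_r X x); lra).
  specialize (HX z ltac:(unfold z; pose proof (Rmax_l X x); lra)).
  assert (Heps : 0 <= eps * exp (- z)).
  { eapply Rle_trans; [apply Rabs_pos|apply (Hdr z); lra]. }
  assert (Hmono : forall s, Rabs s = 1 -> s * r z + eps * exp (- z) <= s * r x + eps * exp (- x)).
  { intros s Hs.
    destruct (MVT_gen (fun t => s * r t + eps * exp (- t)) x z
                (fun t => s * dr t - eps * exp (- t))) as [c [Hc E]].
    - rewrite Rmin_left, Rmax_right by lra. intros t Ht.
      specialize (Hr t ltac:(lra)).
      replace (s * dr t - eps * exp (- t)) with (plus (scal s (dr t)) (- eps * exp (- t)))
        by (unfold plus, scal; simpl; unfold mult; simpl; ring).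
      apply (is_derive_plus (K := R_AbsRing) (V := R_NormedModule)).
      + now apply (is_derive_scal r t s (dr t)).
      + auto_derive; [exact I|]. ring.
    - rewrite Rmin_left, Rmax_right by lra. intros t Ht.
      apply continuity_pt_filterlim.
      apply (continuous_plus (fun t => s * r t) (fun t => eps * exp (- t))).
      + apply (continuous_mult (fun _ => s) r); [apply continuous_const|].
        apply (ex_derive_continuous (K := R_AbsRing) (V := R_NormedModule)).
        exists (dr t); apply Hr; lra.
      + apply (ex_derive_continuous (K := R_AbsRing) (V := R_NormedModule)). auto_derive; exact I.
    - rewrite Rmin_left, Rmax_right in Hc by lra.
      specialize (Hdr c ltac:(lra)).
      assert (s * dr c <= eps * exp (- c)).
      { eapply Rle_trans; [apply Rle_abs|]. now rewrite Rabs_mult, Hs, Rmult_1_l. }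
      nra. }
  pose proof (Hmono 1 Rabs_R1) as H1.
  pose proof (Hmono (-1) ltac:(rewrite Rabs_left; lra)) as H2.
  apply Rabs_le_between in HX. apply Rabs_le. lra.
Qed.

(** Induction on N: the derivative is approximated first, and the approximant is the primitive
    vanishing at infinity. The same eps survives each integration. *)
Lemma exp_span_approx (N : nat) : forall (f : R -> R) (X eps : R),
  smooth f -> (forall x, X <= x -> f x = 0) -> 0 < eps ->
  exists psi, exp_span psi /\ forall m x, (m <= N)%nat -> -1 <= x ->
    Rabs (Derive_n (fun x => f x - psi x) m x) <= eps * exp (- x).
Proof.
  induction N as [|N IH]; intros f X eps Hf HX Heps.
  - destruct (exp_span_approx_uniform f X eps) as (psi & Hpsi & H); auto.
    { intros x; now apply smooth_continuous. }
    exists psi. split; [exact Hpsi|]. intros m x Hm Hx.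
    replace m with 0%nat by lia. now apply H.
  - destruct (IH (Derive f) (X + 1) eps) as (dpsi & Hdpsi & H); auto using smooth_Derive.
    { intros x Hx. apply (Derive_n_locally_zero f 1 x 1); [lra|].
      intros y Hy. apply Rabs_def2 in Hy. apply HX. lra. }
    destruct (exp_span_primitive dpsi Hdpsi) as (psi & Hpsi & Dpsi).
    exists psi. split; [exact Hpsi|].
    assert (Hd : forall x, is_derive (fun x => f x - psi x) x (Derive f x - dpsi x)).
    { intros x. apply (is_derive_minus (K := R_AbsRing) (V := R_NormedModule)).
      - now apply smooth_is_derive.
      - apply Dpsi. }
    intros [|m] x Hm Hx.
    + apply (exp_decay_of_derive (fun x => f x - psi x) (fun x => Derive f x - dpsi x) (-1)).
      * intros t _; apply Hd.
      * intros t Ht. apply (H 0%nat t); [lia|exact Ht].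
      * intros e He. destruct (exp_span_decay psi Hpsi e He) as [Y HY].
        exists (Rmax X Y). intros t Ht.
        rewrite HX by (eapply Rle_trans; [apply Rmax_l|exact Ht]).
        rewrite Rminus_0_l, Rabs_Ropp. apply HY.
        eapply Rle_trans; [apply Rmax_r|exact Ht].
      * exact Hx.
    + rewrite Derive_n_S.
      rewrite (Derive_n_ext _ (fun x => Derive f x - dpsi x)).
      * apply H; [lia|exact Hx].
      * intros t. now apply is_derive_unique.
Qed.

(** * The finite part of H(x)/x *)

Lemma is_RInt_gen_of_lim {V : NormedModule R_AbsRing} (f F : R -> V) (l : V) :
  (forall X, 1 <= X -> is_RInt f 1 X (F X)) ->
  filterlim F (Rbar_locally p_infty) (locally l) ->
  is_RInt_gen f (at_point 1) (Rbar_locally p_infty) l.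
Proof.
  intros HF Hl P HP.
  apply (Filter_prod _ _ _ (fun u => u = 1) (fun X => 1 <= X /\ P (F X))).
  - reflexivity.
  - apply filter_and; [exists 1; intros; lra|exact (Hl P HP)].
  - intros u X -> [HX HPX]. exists (F X). split; [now apply HF|exact HPX].
Qed.

Definition pf_near (f : R -> R) (x : R) : R := / x * (f x - f 0).
Definition pf_far (f : R -> R) (x : R) : R := / x * f x.

(* [is_Pf f p] means that the finite part [<Pf(H(x)/x), f>] exists and equals [p]. *)
Definition is_Pf (f : R -> R) (p : R) : Prop := exists I J : R, p = I + J /\
  is_RInt (pf_near f) 0 1 I /\
  (forall X, 1 <= X -> ex_RInt (pf_far f) 1 X) /\
  filterlim (fun X => RInt (pf_far f) 1 X) (Rbar_locally p_infty) (locally J).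

(** Filling the removable singularity with f'(0) reduces integrability of [pf_near] to continuity,
    since the end point 0 does not affect the integral. *)
Lemma continuous_diff_quot (f : R -> R) : smooth f ->
  forall x, continuous (fun x => if Req_EM_T x 0 then Derive f 0 else pf_near f x) x.
Proof.
  intros Hf x. apply continuity_pt_filterlim.
  destruct (Req_dec x 0) as [->|Hx].
  - pose proof (smooth_is_derive f 0 Hf) as HD. apply is_derive_Reals in HD.
    intros eps Heps. destruct (HD eps Heps) as [d Hd].
    exists d. split; [apply cond_pos|]. intros h [[_ Hh0] Hh].
    simpl in *. unfold R_dist in *.
    destruct (Req_EM_T 0 0) as [_|]; [|lra].
    destruct (Req_EM_T h 0) as [->|Hne]; [rewrite Rminus_diag, Rabs_R0; exact Heps|].
    rewrite Rminus_0_r in Hh. specialize (Hd h Hne Hh). rewrite Rplus_0_l in Hd.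
    unfold pf_near. now rewrite Rmult_comm.
  - apply continuity_pt_filterlim.
    apply continuous_ext_loc with (pf_near f).
    + assert (Hp : 0 < Rabs x) by now apply Rabs_pos_lt.
      exists (mkposreal _ Hp). intros v Hv.
      destruct (Req_EM_T v 0) as [->|]; [|reflexivity].
      unfold ball, abs, minus, plus, opp in Hv; simpl in Hv.
      unfold AbsRing_ball, abs, minus, plus, opp in Hv; simpl in Hv.
      rewrite Rplus_0_l, Rabs_Ropp in Hv. lra.
    + apply (continuous_mult (fun v => / v) (fun v => f v - f 0) x).
      * now apply continuous_Rinv.
      * apply (continuous_minus f (fun _ => f 0)); [now apply smooth_continuous|].
        apply continuous_const.
Qed.

Lemma ex_RInt_pf_near (f : R -> R) (X : R) : smooth f -> 0 <= X -> ex_RInt (pf_near f) 0 X.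
Proof.
  intros Hf HX.
  apply ex_RInt_ext with (fun x => if Req_EM_T x 0 then Derive f 0 else pf_near f x).
  - rewrite Rmin_left by exact HX. intros x Hx. destruct (Req_EM_T x 0); [lra|reflexivity].
  - apply (ex_RInt_continuous (V := R_CompleteNormedModule)). intros; now apply continuous_diff_quot.
Qed.

Lemma ex_RInt_pf_far (f : R -> R) (u v : R) : smooth f -> 0 < u -> 0 < v ->
  ex_RInt (pf_far f) u v.
Proof.
  intros Hf Hu Hv. apply (ex_RInt_continuous (V := R_CompleteNormedModule)). intros x Hx.
  assert (0 < x) by (unfold Rmin in Hx; destruct (Rle_dec u v); lra).
  apply (continuous_mult (fun v => / v) f x).
  - apply continuous_Rinv; lra.
  - now apply smooth_continuous.
Qed.

Lemma RInt_pf_near_bound (f : R -> R) (M : R) : smooth f ->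
  (forall x, Rabs (Derive f x) <= M) -> Rabs (RInt (pf_near f) 0 1) <= M.
Proof.
  intros Hf HM. replace M with ((1 - 0) * M) by ring.
  apply abs_RInt_le_const; [lra|apply ex_RInt_pf_near; [exact Hf|lra]|].
  intros x Hx. unfold pf_near.
  destruct (Req_dec x 0) as [->|Hne].
  { rewrite Rminus_diag, Rmult_0_r, Rabs_R0.
    eapply Rle_trans; [apply Rabs_pos|apply (HM 0)]. }
  destruct (MVT_gen f 0 x (Derive f)) as [c [_ E]].
  - intros t _. now apply smooth_is_derive.
  - intros t _. apply continuity_pt_filterlim. now apply smooth_continuous.
  - rewrite E. replace (/ x * (Derive f c * (x - 0))) with (Derive f c) by (field; lra). apply HM.
Qed.

Lemma RInt_pf_far_bound (f : R -> R) (M u v : R) : smooth f ->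
  (forall x, Rabs x * Rabs (f x) <= M) -> 0 < u -> u <= v ->
  Rabs (RInt (pf_far f) u v) <= M / u.
Proof.
  intros Hf HM Hu Huv.
  assert (HM0 : 0 <= M).
  { specialize (HM 0). rewrite Rabs_R0, Rmult_0_l in HM. exact HM. }
  assert (HI : is_RInt (fun x => M / x ^ 2) u v (M / u - M / v)).
  { replace (M / u - M / v) with (minus (- M / v) (- M / u))
      by (unfold minus, plus, opp; simpl; field; lra).
    apply (is_RInt_derive (fun x => - M / x)).
    - rewrite Rmin_left, Rmax_right by exact Huv. intros x Hx. auto_derive; [lra|]. field. lra.
    - rewrite Rmin_left, Rmax_right by exact Huv. intros x Hx.
      apply (ex_derive_continuous (K := R_AbsRing) (V := R_NormedModule)).
      auto_derive. assert (0 < x * x) by (apply Rmult_lt_0_compat; lra). lra. }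
  apply Rle_trans with (M / u - M / v).
  2: { assert (0 <= M / v) by (apply Rdiv_le_0_compat; lra). lra. }
  eapply Rle_trans; [apply abs_RInt_le; [exact Huv|apply ex_RInt_pf_far; auto; lra]|].
  rewrite <- (is_RInt_unique _ _ _ _ HI).
  apply RInt_le; [exact Huv| | |].
  - apply ex_RInt_norm, ex_RInt_pf_far; auto; lra.
  - eexists; exact HI.
  - intros x Hx. unfold pf_far. rewrite Rabs_mult, Rabs_inv.
    specialize (HM x). rewrite !(Rabs_pos_eq x) in * by lra.
    apply Rmult_le_reg_l with (x ^ 2); [apply pow_lt; lra|].
    replace (x ^ 2 * (/ x * Rabs (f x))) with (x * Rabs (f x)) by (field; lra).
    replace (x ^ 2 * (M / x ^ 2)) with M by (field; lra). exact HM.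
Qed.

(** Each half costs one M: the mean value theorem bounds the near part through f', and |x f(x)| <= M
    bounds the far integrand by M/x^2. The tails M/u of the latter also give the Cauchy
    criterion. *)
Lemma is_Pf_exists (f : R -> R) : rschwartz f -> exists p, is_Pf f p /\
  forall M, seminorms_le 1 M f -> Rabs p <= 2 * M.
Proof.
  intros Hf.
  assert (HM : forall M, seminorms_le 1 M f ->
     (forall x, Rabs (Derive f x) <= M) /\ (forall x, Rabs x * Rabs (f x) <= M)).
  { intros M HM. split; intros x.
    - specialize (HM x 0%nat 1%nat ltac:(lia) ltac:(lia)). simpl in HM.
      now rewrite Rmult_1_l in HM.
    - specialize (HM x 1%nat 0%nat ltac:(lia) ltac:(lia)). simpl in HM.
      now rewrite Rmult_1_r in HM. }
  assert (HJ : exists J, filterlim (fun X => RInt (pf_far f) 1 X) (Rbar_locally p_infty) (locally J)).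
  { destruct (rschwartz_seminorms 1 f Hf) as (M & HM0 & HsM).
    apply (filterlim_locally_cauchy (U := R_CompleteSpace)).
    intros [eps Heps]. simpl.
    set (X0 := Rmax 1 (2 * (M + 1) / eps)).
    assert (HX1 : 1 <= X0) by apply Rmax_l.
    assert (HX : M / X0 < eps).
    { assert (HX2 : 2 * (M + 1) / eps <= X0) by apply Rmax_r.
      apply Rmult_lt_reg_r with X0; [lra|].
      replace (M / X0 * X0) with M by (field; lra).
      apply (Rmult_le_compat_l eps) in HX2; [|lra].
      replace (eps * (2 * (M + 1) / eps)) with (2 * (M + 1)) in HX2 by (field; lra). lra. }
    exists (fun X => X0 < X). split; [exists X0; auto|].
    assert (H : forall u v, X0 < u -> u <= v ->
              Rabs (RInt (pf_far f) 1 v - RInt (pf_far f) 1 u) < eps).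
    { intros u v Hu Huv.
      assert (C : RInt (pf_far f) 1 v = RInt (pf_far f) 1 u + RInt (pf_far f) u v).
      { symmetry. apply (RInt_Chasles (V := R_CompleteNormedModule) (pf_far f));
          apply ex_RInt_pf_far; try apply Hf; lra. }
      rewrite C, Rplus_minus_l.
      eapply Rle_lt_trans; [apply (RInt_pf_far_bound f M); [apply Hf|apply (HM M HsM)|lra|exact Huv]|].
      apply Rle_lt_trans with (M / X0); [|exact HX].
      apply Rmult_le_compat_l; [exact HM0|]. apply Rinv_le_contravar; lra. }
    intros u v Hu Hv. change (Rabs (RInt (pf_far f) 1 v - RInt (pf_far f) 1 u) < eps).
    destruct (Rle_lt_dec u v) as [Huv|Huv]; [now apply H|].
    rewrite Rabs_minus_sym. apply H; lra. }
  destruct HJ as [J HJ].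
  exists (RInt (pf_near f) 0 1 + J). split.
  - exists (RInt (pf_near f) 0 1), J. repeat split; try exact HJ.
    + apply (RInt_correct (V := R_CompleteNormedModule)), ex_RInt_pf_near; [apply Hf|lra].
    + intros X HX. apply ex_RInt_pf_far; [apply Hf|lra|lra].
  - intros M HsM. destruct (HM M HsM) as [H1 H2].
    eapply Rle_trans; [apply Rabs_triang|].
    replace (2 * M) with (M + M) by ring. apply Rplus_le_compat.
    + now apply RInt_pf_near_bound; [apply Hf|].
    + apply (filterlim_le (F := Rbar_locally p_infty)
        (fun X => Rabs (RInt (pf_far f) 1 X)) (fun _ => M) (Finite (Rabs J)) (Finite M)).
      * exists 1. intros X HX. rewrite <- (Rdiv_1_r M).
        apply RInt_pf_far_bound; [apply Hf|exact H2|lra|lra].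
      * eapply filterlim_comp; [exact HJ|]. apply (continuous_Rabs J).
      * apply filterlim_const.
Qed.

Definition Pf_real (f : R -> R) : R :=
  RInt (pf_near f) 0 1 + RInt_gen (pf_far f) (at_point 1) (Rbar_locally p_infty).

Lemma is_Pf_unique (f : R -> R) (p : R) : is_Pf f p -> Pf_real f = p.
Proof.
  intros (I & J & -> & HI & HX & HJ). unfold Pf_real. f_equal.
  - now apply is_RInt_unique.
  - apply (is_RInt_gen_unique (V := R_CompleteNormedModule)).
    apply is_RInt_gen_of_lim with (fun X => RInt (pf_far f) 1 X); [|exact HJ].
    intros X HX1. now apply (RInt_correct (V := R_CompleteNormedModule)), HX.
Qed.

Lemma Pf_real_correct (f : R -> R) : rschwartz f -> is_Pf f (Pf_real f).
Proof.
  intros Hf. destruct (is_Pf_exists f Hf) as (p & Hp & _). now rewrite (is_Pf_unique f p Hp).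
Qed.

Lemma Pf_real_bound (f : R -> R) (M : R) : rschwartz f -> seminorms_le 1 M f ->
  Rabs (Pf_real f) <= 2 * M.
Proof.
  intros Hf HM. destruct (is_Pf_exists f Hf) as (p & Hp & H). rewrite (is_Pf_unique f p Hp).
  now apply H.
Qed.

Lemma is_Pf_plus_scal (f h : R -> R) (c p s : R) : is_Pf f p -> is_Pf h s ->
  is_Pf (fun x => f x + c * h x) (p + c * s).
Proof.
  intros (I1 & J1 & -> & A1 & B1 & C1) (I2 & J2 & -> & A2 & B2 & C2).
  assert (E : forall X, 1 <= X -> is_RInt (pf_far (fun x => f x + c * h x)) 1 X
                (RInt (pf_far f) 1 X + c * RInt (pf_far h) 1 X)).
  { intros X HX.
    apply is_RInt_ext with (fun x => plus (pf_far f x) (scal c (pf_far h x))).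
    - intros x _. unfold pf_far, plus, scal; simpl; unfold mult; simpl. ring.
    - apply (is_RInt_plus (V := R_NormedModule)).
      + now apply (RInt_correct (V := R_CompleteNormedModule)), B1.
      + apply (is_RInt_scal (V := R_NormedModule)).
        now apply (RInt_correct (V := R_CompleteNormedModule)), B2. }
  exists (I1 + c * I2), (J1 + c * J2). repeat split.
  - ring.
  - apply is_RInt_ext with (fun x => plus (pf_near f x) (scal c (pf_near h x))).
    + intros x _. unfold pf_near, plus, scal; simpl; unfold mult; simpl. ring.
    + apply (is_RInt_plus (V := R_NormedModule)); [exact A1|].
      now apply (is_RInt_scal (V := R_NormedModule)).
  - intros X HX. eexists. now apply E.
  - apply filterlim_ext_loc with (fun X => plus (RInt (pf_far f) 1 X) (scal c (RInt (pf_far h) 1 X))).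
    + exists 1. intros X HX. symmetry. apply is_RInt_unique, E. lra.
    + eapply filterlim_comp_2; [exact C1| |apply (filterlim_plus (V := R_NormedModule) J1 (c * J2))].
      eapply filterlim_comp; [exact C2|].
      apply (filterlim_scal_r (V := R_NormedModule) c J2).
Qed.

Lemma Pf_real_plus_scal (f h : R -> R) (c : R) : rschwartz f -> rschwartz h ->
  Pf_real (fun x => f x + c * h x) = Pf_real f + c * Pf_real h.
Proof.
  intros Hf Hh. apply is_Pf_unique, is_Pf_plus_scal; now apply Pf_real_correct.
Qed.

Lemma Pf_real_ext (f h : R -> R) : rschwartz f -> (forall x, 0 <= x -> f x = h x) ->
  Pf_real h = Pf_real f.
Proof.
  intros Hf E. destruct (Pf_real_correct f Hf) as (I & J & -> & HI & HX & HJ).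
  apply is_Pf_unique. exists I, J. repeat split.
  - apply is_RInt_ext with (pf_near f); [|exact HI].
    rewrite Rmin_left, Rmax_right by lra. intros x Hx. unfold pf_near. now rewrite !E by lra.
  - intros X HX1. apply ex_RInt_ext with (pf_far f); [|now apply HX].
    rewrite Rmin_left, Rmax_right by lra. intros x Hx. unfold pf_far. now rewrite E by lra.
  - apply filterlim_ext_loc with (fun X => RInt (pf_far f) 1 X); [|exact HJ].
    exists 1. intros X HX1. apply RInt_ext.
    rewrite Rmin_left, Rmax_right by lra. intros x Hx. unfold pf_far. now rewrite E by lra.
Qed.

Lemma Pf_H_over_x_pair (phi : R -> CC) :
  rschwartz (fun x => Re (phi x)) -> rschwartz (fun x => Im (phi x)) ->
  Pf_H_over_x phi = (Pf_real (fun x => Re (phi x)), Pf_real (fun x => Im (phi x))).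
Proof.
  intros Hre Him.
  destruct (Pf_real_correct _ Hre) as (I1 & J1 & E1 & A1 & B1 & C1).
  destruct (Pf_real_correct _ Him) as (I2 & J2 & E2 & A2 & B2 & C2).
  rewrite E1, E2. unfold Pf_H_over_x.
  transitivity (Cplus (I1, I2) (J1, J2)); [|reflexivity].
  f_equal.
  - apply (is_RInt_unique (V := C_R_CompleteNormedModule)).
    apply (is_RInt_ext (V := C_R_NormedModule)
      (fun x => (pf_near (fun x => Re (phi x)) x, pf_near (fun x => Im (phi x)) x))).
    + intros x _. unfold pf_near, Cmult, Cminus, Cplus, Copp, RtoC, Re, Im; simpl. f_equal; ring.
    + now apply (is_RInt_fct_extend_pair (U := R_NormedModule) (V := R_NormedModule)).
  - apply (is_RInt_gen_unique (V := C_R_CompleteNormedModule)).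
    apply (is_RInt_gen_of_lim (V := C_R_NormedModule) _
      (fun X => (RInt (pf_far (fun x => Re (phi x))) 1 X, RInt (pf_far (fun x => Im (phi x))) 1 X))).
    + intros X HX. apply (is_RInt_ext (V := C_R_NormedModule)
        (fun x => (pf_far (fun x => Re (phi x)) x, pf_far (fun x => Im (phi x)) x))).
      * intros x _. unfold pf_far, Cmult, RtoC, Re, Im; simpl. f_equal; ring.
      * apply (is_RInt_fct_extend_pair (U := R_NormedModule) (V := R_NormedModule)); simpl;
          apply (RInt_correct (V := R_CompleteNormedModule)); [now apply B1|now apply B2].
    (* A ball of the complex numbers, seen as a real module, is a product of two balls, so the two
       real limits combine. *)
    + apply (filterlim_pair (G := locally J1) (H := locally J2)) with (1 := C1) in C2.
      intros P [eps HP]. apply C2.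
      apply (Filter_prod _ _ _ (ball J1 eps) (ball J2 eps)).
      * now exists eps.
      * now exists eps.
      * intros u v Hu Hv. apply HP. now split.
Qed.

(** * Euler's constant and the finite part of an exponential *)

Lemma one_minus_pow_ge (s : R) (n : nat) : 0 <= s <= 1 -> 1 - INR n * s <= (1 - s) ^ n.
Proof.
  intros Hs. induction n as [|n IH]; [simpl; lra|].
  rewrite S_INR. simpl. pose proof (pos_INR n). nra.
Qed.

(** With t = x/N one has e^{-t} (1 - t^2) <= 1 - t <= e^{-t}; take N-th powers and apply Bernoulli's
    inequality to (1 - t^2)^N. *)
Lemma exp_minus_pow_bounds (N : nat) (x : R) : (0 < N)%nat -> 0 <= x <= INR N ->
  0 <= exp (- x) - (1 - x / INR N) ^ N <= x ^ 2 * exp (- x) / INR N.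
Proof.
  intros HN Hx. assert (HN0 : 0 < INR N) by now apply lt_0_INR.
  set (t := x / INR N).
  assert (Ht : 0 <= t <= 1).
  { split; [apply Rdiv_le_0_compat; lra|]. unfold t.
    apply Rmult_le_reg_r with (INR N); [exact HN0|].
    unfold Rdiv. rewrite Rmult_assoc, Rinv_l; lra. }
  assert (E : exp (- x) = exp (- t) ^ N).
  { rewrite <- Rpower_pow by apply exp_pos. unfold Rpower. rewrite ln_exp. f_equal.
    unfold t. field. lra. }
  split.
  - enough ((1 - t) ^ N <= exp (- x)) by lra. rewrite E. apply pow_incr.
    pose proof (exp_ineq1_le (- t)). lra.
  - assert (H1 : exp (- t) * (1 - t ^ 2) <= 1 - t).
    { pose proof (exp_ineq1_le t). pose proof (exp_pos t). pose proof (exp_pos (- t)).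
      assert (E1 : exp (- t) * exp t = 1) by (rewrite <- exp_plus, Rplus_opp_l; apply exp_0).
      assert (exp (- t) * (1 + t) <= 1) by (rewrite <- E1; apply Rmult_le_compat_l; lra).
      replace (exp (- t) * (1 - t ^ 2)) with (exp (- t) * (1 + t) * (1 - t)) by ring.
      nra. }
    assert (H2 : exp (- x) * (1 - INR N * t ^ 2) <= (1 - t) ^ N).
    { apply Rle_trans with ((exp (- t) * (1 - t ^ 2)) ^ N).
      - rewrite Rpow_mult_distr, <- E. apply Rmult_le_compat_l; [left; apply exp_pos|].
        apply one_minus_pow_ge. nra.
      - apply pow_incr. split; [|exact H1].
        apply Rmult_le_pos; [left; apply exp_pos|nra]. }
    replace (x ^ 2 * exp (- x) / INR N) with (exp (- x) * (INR N * t ^ 2))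
      by (unfold t; field; lra).
    lra.
Qed.

(** The classical entire exponential integral; its difference with ln X tends to Euler's
    constant. *)
Definition Ein (X : R) : R := RInt (fun x => / x * (1 - exp (- x))) 0 X.

Lemma ex_RInt_Ein (X : R) : 0 <= X -> ex_RInt (fun x => / x * (1 - exp (- x))) 0 X.
Proof.
  intros HX.
  apply ex_RInt_ext with (fun x => scal (-1) (pf_near (fun x => exp (- (1 * x))) x)).
  - intros x _. unfold pf_near, scal; simpl; unfold mult; simpl.
    rewrite Rmult_0_r, Ropp_0, exp_0, Rmult_1_l. ring.
  - apply (ex_RInt_scal (V := R_NormedModule)), ex_RInt_pf_near; [|exact HX].
    apply smooth_exp_lin.
Qed.

Lemma geom_sum (s : R) (n : nat) : (1 - s) * sum_f_R0 (fun k => s ^ k) n = 1 - s ^ S n.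
Proof.
  induction n as [|n IH]; [simpl; ring|].
  rewrite tech5, Rmult_plus_distr_l, IH. simpl. ring.
Qed.

(* The harmonic number [H_N] is the integral of [(1 - (1 - x/N)^N) / x] over [[0, N]]. *)
Lemma Ein_harmonic (n : nat) :
  Rabs (Ein (INR (S n)) - sum_f_R0 (fun k => / INR (S k)) n) <= / INR (S n).
Proof.
  set (N := S n). assert (HN : 0 < INR N) by (apply lt_0_INR; unfold N; lia).
  (* The quotient (1 - (1 - x/N)^N)/x as a geometric sum, which has no singularity at 0 and can be
     integrated term by term. *)
  set (G := fun x => sum_f_R0 (fun k => / INR N * (1 - x / INR N) ^ k) n).
  assert (HG : is_RInt G 0 (INR N) (sum_f_R0 (fun k => / INR (S k)) n)).
  (* Every term of this primitive vanishes at x = N, so the integral is -P(0), the harmonic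
     number. *)
  { set (P := fun m x => sum_f_R0 (fun k => - / INR (S k) * (1 - x / INR N) ^ S k) m).
    assert (DP : forall m x, is_derive (P m) x (sum_f_R0 (fun k => / INR N * (1 - x / INR N) ^ k) m)).
    { assert (D1 : forall k x, is_derive (fun x => - / INR (S k) * (1 - x / INR N) ^ S k) x
                (/ INR N * (1 - x / INR N) ^ k)).
      { clearbody N. intros k x. assert (INR (S k) <> 0) by now apply not_0_INR.
        replace (/ INR N * (1 - x / INR N) ^ k)
          with (- / INR (S k) * (INR (S k) * (- / INR N) * (1 - x / INR N) ^ pred (S k)))
          by (simpl pred; generalize ((1 - x / INR N) ^ k); intros w; field; split; lra).
        apply (is_derive_scal (fun x => (1 - x / INR N) ^ S k)).
        apply (is_derive_pow (fun x => 1 - x / INR N)).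
        auto_derive; [lra|field; lra]. }
      intros m x; induction m as [|m IH]; [exact (D1 0%nat x)|].
      apply (is_derive_plus (K := R_AbsRing) (V := R_NormedModule)); [exact IH|exact (D1 (S m) x)]. }
    assert (E0 : P n 0 = - sum_f_R0 (fun k => / INR (S k)) n).
    { replace (- sum_f_R0 (fun k => / INR (S k)) n)
        with (-1 * sum_f_R0 (fun k => / INR (S k)) n) by ring.
      rewrite scal_sum. apply sum_eq. intros k _.
      unfold Rdiv. rewrite Rmult_0_l, Rminus_0_r, pow1. ring. }
    assert (EN : P n (INR N) = 0).
    { rewrite <- (sum_eq_R0 (fun k => - / INR (S k) * (1 - INR N / INR N) ^ S k) n); [reflexivity|].
      intros k _. replace (1 - INR N / INR N) with 0 by (field; lra). simpl. ring. }
    replace (sum_f_R0 (fun k => / INR (S k)) n) with (minus (P n (INR N)) (P n 0))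
      by (rewrite E0, EN; unfold minus, plus, opp; simpl; ring).
    apply (is_RInt_derive (P n) G).
    - intros x _. apply DP.
    - intros x _. unfold G. clear. clearbody N. induction n as [|m IH].
      + apply continuous_const.
      + apply (continuous_plus (fun x => sum_f_R0 (fun k => / INR N * (1 - x / INR N) ^ k) m)
                (fun x => / INR N * (1 - x / INR N) ^ S m) x IH).
        apply (ex_derive_continuous (K := R_AbsRing) (V := R_NormedModule)). auto_derive; exact I. }
  assert (HB : is_RInt (fun x => / INR N * (x * exp (- x))) 0 (INR N)
                 (/ INR N * (1 - (INR N + 1) * exp (- INR N)))).
  { replace (/ INR N * (1 - (INR N + 1) * exp (- INR N))) with
      (minus (- / INR N * ((INR N + 1) * exp (- INR N))) (- / INR N * ((0 + 1) * exp (- 0))))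
      by (unfold minus, plus, opp; simpl; rewrite Ropp_0, exp_0; ring).
    apply (is_RInt_derive (fun x => - / INR N * ((x + 1) * exp (- x)))).
    - intros x _. clearbody N. auto_derive; [exact I|]. ring.
    - intros x _. apply (ex_derive_continuous (K := R_AbsRing) (V := R_NormedModule)).
      auto_derive. exact I. }
  rewrite <- (is_RInt_unique _ _ _ _ HG). unfold Ein.
  assert (HE := ex_RInt_Ein (INR N) (Rlt_le _ _ HN)).
  assert (HGe : ex_RInt G 0 (INR N)) by (eexists; exact HG).
  rewrite <- (RInt_minus (V := R_CompleteNormedModule) _ G) by assumption.
  (* [exp_minus_pow_bounds] divided by x bounds the integrand by x e^{-x}/N, and the integral of x
     e^{-x} over [0, N] is at most 1. *)
  apply Rle_trans with (RInt (fun x => / INR N * (x * exp (- x))) 0 (INR N)).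
  2: { rewrite (is_RInt_unique _ _ _ _ HB). rewrite <- (Rmult_1_r (/ INR N)) at 2.
       apply Rmult_le_compat_l; [left; now apply Rinv_0_lt_compat|].
       pose proof (exp_pos (- INR N)). nra. }
  assert (HD : ex_RInt (fun x => minus (/ x * (1 - exp (- x))) (G x)) 0 (INR N))
    by now apply (ex_RInt_minus (V := R_NormedModule)).
  eapply Rle_trans; [apply abs_RInt_le; [lra|exact HD]|].
  apply RInt_le; [lra|apply ex_RInt_norm; exact HD|eexists; exact HB|].
  intros x Hx.
  assert (EG : x * G x = 1 - (1 - x / INR N) ^ N).
  { unfold N at 2. rewrite <- geom_sum. unfold G.
    replace (1 - (1 - x / INR N)) with (x * / INR N) by (field; lra).
    rewrite Rmult_assoc. f_equal. rewrite scal_sum. apply sum_eq. intros; ring. }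
  destruct (exp_minus_pow_bounds N x ltac:(unfold N; lia) ltac:(lra)) as [B1 B2].
  change (Rabs (/ x * (1 - exp (- x)) - G x) <= / INR N * (x * exp (- x))).
  replace (/ x * (1 - exp (- x)) - G x) with (- (/ x * (exp (- x) - (1 - x / INR N) ^ N))).
  2: { replace (G x) with (/ x * (x * G x)) by (field; lra). rewrite EG. ring. }
  rewrite Rabs_Ropp, Rabs_pos_eq.
  - apply Rmult_le_reg_l with x; [lra|].
    rewrite <- Rmult_assoc, Rinv_r, Rmult_1_l by lra.
    replace (x * (/ INR N * (x * exp (- x)))) with (x ^ 2 * exp (- x) / INR N) by (field; lra).
    exact B2.
  - apply Rmult_le_pos; [left; apply Rinv_0_lt_compat; lra|exact B1].
Qed.

(** The near part is -Ein(y), and the far part up to X is ln X - Ein(yX) + Ein(y). The sum ln X -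
    Ein(yX) tends to -gamma - ln y. *)
Lemma Pf_real_exp (f : R -> R) (y : R) : 0 < y -> rschwartz f ->
  (forall x, 0 <= x -> f x = exp (- (y * x))) -> Pf_real f = - euler_gamma - ln y.
Proof.
  intros Hy Hf Ef.
  destruct (Pf_real_correct f Hf) as (I & J & E & HI & HX & HJ). rewrite E.
  assert (HEin : forall u v, 0 <= u -> u <= v ->
            is_RInt (fun x => / x * (1 - exp (- (y * x)))) u v (Ein (y * v) - Ein (y * u))).
  { intros u v Hu Huv.
    apply is_RInt_ext with (fun x => scal y ((fun t => / t * (1 - exp (- t))) (y * x + 0))).
    - rewrite Rmin_left, Rmax_right by exact Huv. intros x Hx.
      unfold scal; simpl; unfold mult; simpl. rewrite Rplus_0_r. field. lra.
    - apply (is_RInt_comp_lin (V := R_NormedModule) (fun t => / t * (1 - exp (- t))) y 0 u v). rewrite !Rplus_0_r.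
      assert (A1 : 0 <= y * u) by (apply Rmult_le_pos; lra).
      assert (A2 : 0 <= y * v) by (apply Rmult_le_pos; lra).
      replace (Ein (y * v) - Ein (y * u)) with (plus (opp (Ein (y * u))) (Ein (y * v)))
        by (unfold plus, opp; simpl; ring).
      apply (is_RInt_Chasles (V := R_NormedModule)) with 0.
      + apply (is_RInt_swap (V := R_NormedModule)).
        now apply (RInt_correct (V := R_CompleteNormedModule)), ex_RInt_Ein.
      + now apply (RInt_correct (V := R_CompleteNormedModule)), ex_RInt_Ein. }
  assert (EI : I = - Ein y).
  { rewrite <- (is_RInt_unique _ _ _ _ HI). apply is_RInt_unique.
    apply is_RInt_ext with (fun x => opp (/ x * (1 - exp (- (y * x))))).
    - rewrite Rmin_left, Rmax_right by lra. intros x Hx. unfold pf_near.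
      rewrite !Ef, Rmult_0_r, Ropp_0, exp_0 by lra. unfold opp; simpl. ring.
    - replace (- Ein y) with (opp (Ein (y * 1) - Ein (y * 0))).
      + apply (is_RInt_opp (V := R_NormedModule)), HEin; lra.
      + unfold Ein at 2. rewrite Rmult_0_r, RInt_point, Rmult_1_r.
        unfold opp, zero; simpl. ring. }
  assert (EJ : forall X, 1 <= X -> RInt (pf_far f) 1 X = ln X - (Ein (y * X) - Ein y)).
  { intros X HX1. apply is_RInt_unique.
    apply is_RInt_ext with (fun x => minus (/ x) (/ x * (1 - exp (- (y * x))))).
    - rewrite Rmin_left, Rmax_right by lra. intros x Hx. unfold pf_far.
      rewrite Ef by lra. unfold minus, plus, opp; simpl. ring.
    - replace (ln X - (Ein (y * X) - Ein y)) with
        (minus (minus (ln X) (ln 1)) (Ein (y * X) - Ein (y * 1)))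
        by (rewrite ln_1, Rmult_1_r; unfold minus, plus, opp; simpl; ring).
      apply (is_RInt_minus (V := R_NormedModule)); [|apply HEin; lra].
      apply (is_RInt_derive ln).
      + rewrite Rmin_left, Rmax_right by lra. intros x Hx. auto_derive; [lra|field; lra].
      + rewrite Rmin_left, Rmax_right by lra. intros x Hx. apply continuous_Rinv; lra. }
  (* The far integral is sampled at X = (n + 1)/y, so that Ein is evaluated at the integers where it
     is compared with harmonic numbers. *)
  assert (L1 : is_lim_seq (fun n => Ein (INR (S n)) - ln (INR (S n))) (- (I + J) - ln y)).
  { assert (Hinf : is_lim_seq (fun n => INR (S n) / y) p_infty).
    { apply (is_lim_seq_ext (fun n => / y * INR (S n))); [intros; unfold Rdiv; ring|].
      replace p_infty with (Rbar_mult (/ y) p_infty).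
      - apply is_lim_seq_scal_l, (is_lim_seq_incr_1 INR), is_lim_seq_INR.
      - apply is_Rbar_mult_unique.
        assert (0 < / y) by now apply Rinv_0_lt_compat.
        unfold is_Rbar_mult, Rbar_mult'. destruct (Rle_dec 0 (/ y)) as [h|h]; [|lra].
        destruct (Rle_lt_or_eq_dec 0 (/ y) h); [reflexivity|lra]. }
    assert (HJn : is_lim_seq (fun n => RInt (pf_far f) 1 (INR (S n) / y)) J).
    { eapply filterlim_comp; [exact Hinf|exact HJ]. }
    apply is_lim_seq_ext_loc with
      (fun n => (Ein y - ln y) - RInt (pf_far f) 1 (INR (S n) / y)).
    - assert (Hev : eventually (fun n => 1 < INR (S n) / y)).
      { apply Hinf. exists 1. auto. }
      destruct Hev as [n0 Hev]. exists n0. intros n Hn. specialize (Hev n Hn).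
      rewrite EJ by lra. replace (y * (INR (S n) / y)) with (INR (S n)) by (field; lra).
      rewrite ln_div; [ring|apply lt_0_INR; lia|exact Hy].
    - replace (- (I + J) - ln y) with ((Ein y - ln y) - J) by (rewrite EI; ring).
      apply is_lim_seq_minus'; [apply is_lim_seq_const|exact HJn]. }
  assert (L2 : is_lim_seq (fun n => sum_f_R0 (fun k => / INR (S k)) n - Ein (INR (S n))) 0).
  { assert (Hinv : is_lim_seq (fun n => / INR (S n)) 0).
    { replace (Finite 0) with (Rbar_inv p_infty) by reflexivity.
      apply is_lim_seq_inv; [apply (is_lim_seq_incr_1 INR), is_lim_seq_INR|discriminate]. }
    apply is_lim_seq_le_le with (fun n => - / INR (S n)) (fun n => / INR (S n)).
    - intros n. pose proof (Ein_harmonic n) as H. apply Rabs_le_between in H. lra.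
    - replace (Finite 0) with (Rbar_opp 0) by (simpl; f_equal; ring).
      now apply is_lim_seq_opp in Hinv.
    - exact Hinv. }
  assert (L : is_lim_seq (fun n => sum_f_R0 (fun k => / INR (S k)) n - ln (INR (S n)))
                (- (I + J) - ln y)).
  { replace (- (I + J) - ln y) with (0 + (- (I + J) - ln y)) by ring.
    eapply is_lim_seq_ext; [|apply (is_lim_seq_plus' _ _ _ _ L2 L1)].
    intros n; simpl; ring. }
  unfold euler_gamma. rewrite (is_lim_seq_unique _ _ L). simpl. ring.
Qed.

(** * The Tauberian argument *)

(** Powers of x cost at most lam^N, and derivatives only gain. The growth in lam is harmless: the
    lemma is applied to one lam at a time, and uniformity comes from Banach-Steinhaus. *)
Lemma seminorms_le_dilate (N : nat) (M lam : R) (f : R -> R) : smooth f -> 1 <= lam ->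
  seminorms_le N M f -> seminorms_le N (lam ^ N * M) (fun x => f (x / lam)).
Proof.
  intros Sf Hl Hf x k m Hk Hm.
  assert (Hi : 0 < / lam) by (apply Rinv_0_lt_compat; lra).
  replace (fun x => f (x / lam)) with (fun x => f (/ lam * x))
    by (extensionality t; f_equal; unfold Rdiv; ring).
  rewrite Derive_n_scale_arg by exact Sf.
  specialize (Hf (/ lam * x) k m Hk Hm).
  rewrite Rabs_mult, Rpow_mult_distr, (Rabs_pos_eq (/ lam)) in Hf by lra.
  rewrite Rabs_mult, (Rabs_pos_eq ((/ lam) ^ m)) by (apply pow_le; lra).
  set (D := Rabs (Derive_n f m (/ lam * x))) in *.
  assert (HD : 0 <= Rabs x ^ k * D) by (apply Rmult_le_pos; [apply abs_pow_ge_0|apply Rabs_pos]).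
  assert (H1 : (/ lam) ^ m <= 1).
  { rewrite <- (pow1 m). apply pow_incr. split; [lra|].
    rewrite <- Rinv_1. apply Rinv_le_contravar; lra. }
  assert (H2 : lam ^ k <= lam ^ N) by (apply Rle_pow; [exact Hl|exact Hk]).
  assert (H3 : lam ^ k * (/ lam) ^ k = 1) by (rewrite <- Rpow_mult_distr, Rinv_r, pow1; lra).
  assert (H4 : 1 <= lam ^ k) by (apply pow_R1_Rle; exact Hl).
  assert (H5 : 0 <= (/ lam) ^ k * Rabs x ^ k * D).
  { rewrite Rmult_assoc. apply Rmult_le_pos; [apply pow_le; lra|exact HD]. }
  apply Rle_trans with (Rabs x ^ k * D).
  { replace (Rabs x ^ k * ((/ lam) ^ m * D)) with ((/ lam) ^ m * (Rabs x ^ k * D)) by ring.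
    rewrite <- (Rmult_1_l (Rabs x ^ k * D)) at 2. now apply Rmult_le_compat_r. }
  replace (Rabs x ^ k * D) with (lam ^ k * ((/ lam) ^ k * Rabs x ^ k * D))
    by (rewrite <- !Rmult_assoc, H3; ring).
  apply Rmult_le_compat; lra.
Qed.

Lemma rschwartz_dilate (lam : R) (f : R -> R) : 1 <= lam -> rschwartz f ->
  rschwartz (fun x => f (x / lam)).
Proof.
  intros Hl Hf. split.
  - replace (fun x => f (x / lam)) with (fun x => f (/ lam * x))
      by (extensionality t; f_equal; unfold Rdiv; ring).
    apply smooth_scale_arg, Hf.
  - intros k m. destruct (rschwartz_seminorms (k + m) f Hf) as (M & _ & HM).
    exists (lam ^ (k + m) * M). intros x.
    apply seminorms_le_dilate; try assumption; [apply Hf|lia|lia].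
Qed.

Lemma cderive_n_RtoC (f : R -> R) (m : nat) (x : R) :
  cderive_n (fun t => RtoC (f t)) m x = RtoC (Derive_n f m x).
Proof.
  unfold cderive_n, RtoC. simpl. f_equal. apply Derive_n_zero.
Qed.

Lemma schwartz_RtoC (f : R -> R) : rschwartz f -> schwartz (fun x => RtoC (f x)).
Proof.
  intros [Sf Hf]. split; [exact Sf|split; [exact (smooth_const 0)|]].
  intros k m. destruct (Hf k m) as [M HM]. exists M. intros x.
  rewrite cderive_n_RtoC, Cmod_R. apply HM.
Qed.

Lemma schwartz_parts (phi : R -> CC) : schwartz phi ->
  rschwartz (fun x => Re (phi x)) /\ rschwartz (fun x => Im (phi x)).
Proof.
  intros (S1 & S2 & H).
  split; (split; [assumption|]); intros k m; destruct (H k m) as [M HM]; exists M; intros x;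
    (eapply Rle_trans; [|apply (HM x)]); (apply Rmult_le_compat_l; [apply abs_pow_ge_0|]);
    (eapply Rle_trans; [|apply Rmax_Cmod]); [apply Rmax_l|apply Rmax_r].
Qed.

(** The left side of the Tauberian hypothesis multiplied by lam, so that O(1/lam) becomes
    boundedness. *)
Definition rescaled (g : (R -> CC) -> CC) (b : CC) (lam : R) (f : R -> R) : CC :=
  (g (fun x => RtoC (f (x / lam)%R)) - b * RtoC (ln lam * f 0))%C.

Definition limit_functional (a b : CC) (f : R -> R) : CC :=
  ((a + b * RtoC euler_gamma) * RtoC (f 0) + b * RtoC (Pf_real f))%C.

Lemma tempered_real_linear (g : (R -> CC) -> CC) (f h : R -> R) (c : R) :
  tempered g -> rschwartz f -> rschwartz h ->
  g (fun x => RtoC (f x + c * h x)) =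
    (g (fun x => RtoC (f x)) + RtoC c * g (fun x => RtoC (h x)))%C.
Proof.
  intros (Hadd & Hscal & _) Hf Hh.
  rewrite <- Hscal by now apply schwartz_RtoC.
  rewrite <- Hadd.
  - f_equal. extensionality x. now rewrite RtoC_plus, RtoC_mult.
  - now apply schwartz_RtoC.
  - replace (fun x => (RtoC c * RtoC (h x))%C) with (fun x => RtoC (c * h x))
      by (extensionality x; apply RtoC_mult).
    now apply schwartz_RtoC, rschwartz_scal.
Qed.

Lemma rescaled_linear (g : (R -> CC) -> CC) (b : CC) (lam c : R) (f h : R -> R) :
  tempered g -> 1 <= lam -> rschwartz f -> rschwartz h ->
  rescaled g b lam (fun x => f x + c * h x) =
    (rescaled g b lam f + RtoC c * rescaled g b lam h)%C.
Proof.
  intros Hg Hl Hf Hh. unfold rescaled.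
  rewrite (tempered_real_linear g (fun x => f (x / lam)) (fun x => h (x / lam)) c)
    by (auto using rschwartz_dilate).
  rewrite !RtoC_mult, RtoC_plus, RtoC_mult. ring.
Qed.

Lemma limit_functional_linear (a b : CC) (c : R) (f h : R -> R) :
  rschwartz f -> rschwartz h ->
  limit_functional a b (fun x => f x + c * h x) =
    (limit_functional a b f + RtoC c * limit_functional a b h)%C.
Proof.
  intros Hf Hh. unfold limit_functional.
  rewrite Pf_real_plus_scal, !RtoC_plus, !RtoC_mult by assumption. ring.
Qed.

Lemma seminorms_le_at_0 (N : nat) (M : R) (f : R -> R) : seminorms_le N M f -> Rabs (f 0) <= M.
Proof.
  intros H. specialize (H 0 0%nat 0%nat ltac:(lia) ltac:(lia)). simpl in H.
  now rewrite Rmult_1_l in H.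
Qed.

Lemma rescaled_continuous (g : (R -> CC) -> CC) (b : CC) (lam : R) :
  tempered g -> 1 <= lam -> exists (K : R) (N : nat), 0 <= K /\
    forall f M, rschwartz f -> seminorms_le N M f -> Cmod (rescaled g b lam f) <= K * M.
Proof.
  intros (_ & _ & K & N & HK) Hl.
  exists (Rabs K * lam ^ N + Cmod b * Rabs (ln lam)), N.
  assert (Hp : 0 <= lam ^ N) by (apply pow_le; lra).
  assert (H1 : 0 <= Rabs K * lam ^ N) by (apply Rmult_le_pos; [apply Rabs_pos|exact Hp]).
  assert (H2 : 0 <= Cmod b * Rabs (ln lam)) by (apply Rmult_le_pos; [apply Cmod_ge_0|apply Rabs_pos]).
  split; [lra|]. intros f M Hf HM.
  pose proof (seminorms_le_at_0 N M f HM) as H0.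
  assert (HM0 : 0 <= M) by (pose proof (Rabs_pos (f 0)); lra).
  unfold rescaled, Cminus. eapply Rle_trans; [apply Cmod_triangle|].
  rewrite Cmod_opp, Cmod_mult, Cmod_R, Rabs_mult, Rmult_plus_distr_r.
  apply Rplus_le_compat.
  - eapply Rle_trans.
    + apply (HK (fun x => RtoC (f (x / lam)))) with (M := lam ^ N * M).
      * now apply schwartz_RtoC, rschwartz_dilate.
      * intros x k m Hk Hm. rewrite cderive_n_RtoC, Cmod_R.
        apply (seminorms_le_dilate N M lam f); auto. apply Hf.
    + rewrite Rmult_assoc. apply Rmult_le_compat_r; [now apply Rmult_le_pos|apply Rle_abs].
  - rewrite <- Rmult_assoc. now apply Rmult_le_compat_l.
Qed.

Lemma limit_functional_bound (a b : CC) : exists K, 0 <= K /\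
  forall f M, rschwartz f -> seminorms_le 1 M f -> Cmod (limit_functional a b f) <= K * M.
Proof.
  set (A := Cmod (a + b * RtoC euler_gamma)%C).
  assert (HA : 0 <= A) by apply Cmod_ge_0. assert (HB := Cmod_ge_0 b).
  exists (A + Cmod b * 2). split; [lra|].
  intros f M Hf HM. unfold limit_functional. eapply Rle_trans; [apply Cmod_triangle|].
  rewrite !Cmod_mult, !Cmod_R. fold A. rewrite Rmult_plus_distr_r.
  apply Rplus_le_compat.
  - apply Rmult_le_compat_l; [exact HA|]. now apply (seminorms_le_at_0 1).
  - rewrite Rmult_assoc. apply Rmult_le_compat_l; [exact HB|]. now apply Pf_real_bound.
Qed.

Lemma Pf_real_zero_on_nonneg (f : R -> R) : (forall x, 0 <= x -> f x = 0) -> Pf_real f = 0.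
Proof.
  intros H. rewrite (Pf_real_ext (fun _ => 0) f rschwartz_zero) by (intros; now rewrite H).
  pose proof (Pf_real_bound (fun _ => 0) 0 rschwartz_zero (seminorms_le_zero 1)) as B.
  apply Rabs_le_between in B. lra.
Qed.

(** The remainder of the asserted expansion multiplied by lam; the theorem says that it tends to
    0. *)
Definition deviation (g : (R -> CC) -> CC) (a b : CC) (lam : R) (f : R -> R) : CC :=
  (rescaled g b lam f - limit_functional a b f)%C.

Lemma deviation_linear (g : (R -> CC) -> CC) (a b : CC) (lam c : R) (f h : R -> R) :
  tempered g -> 1 <= lam -> rschwartz f -> rschwartz h ->
  deviation g a b lam (fun x => f x + c * h x) =
    (deviation g a b lam f + RtoC c * deviation g a b lam h)%C.
Proof.
  intros Hg Hl Hf Hh. unfold deviation.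
  rewrite rescaled_linear, limit_functional_linear by assumption. ring.
Qed.

Lemma deviation_plus (g : (R -> CC) -> CC) (a b : CC) (lam : R) (f h : R -> R) :
  tempered g -> 1 <= lam -> rschwartz f -> rschwartz h ->
  deviation g a b lam (fun x => f x + h x) =
    (deviation g a b lam f + deviation g a b lam h)%C.
Proof.
  intros Hg Hl Hf Hh.
  replace (fun x => f x + h x) with (fun x => f x + 1 * h x) by (extensionality x; ring).
  rewrite deviation_linear by assumption. ring.
Qed.

(** Dilation preserves the negative axis. The left bound d is there because [supported_nonneg]
    speaks of compactly supported test functions; this is why a function is truncated on both sides
    before its negative part is discarded. *)
Lemma deviation_negative_support (g : (R -> CC) -> CC) (a b : CC) (lam : R) (f : R -> R) (d c : R) :
  supported_nonneg g -> 1 <= lam -> rschwartz f -> c < 0 ->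
  (forall x, x <= d \/ c <= x -> f x = 0) -> deviation g a b lam f = RtoC 0.
Proof.
  intros Hg Hl Hf Hc H. unfold deviation, rescaled, limit_functional.
  rewrite Pf_real_zero_on_nonneg by (intros; apply H; lra).
  rewrite (H 0) by lra. rewrite Hg.
  - rewrite Rmult_0_r. ring.
  - now apply schwartz_RtoC, rschwartz_dilate.
  - exists (lam * d), (lam * c). split; [nra|].
    intros x Hx. rewrite H; [reflexivity|].
    destruct Hx as [Hx|Hx]; [left|right]; apply Rmult_le_reg_l with lam; try lra;
      replace (lam * (x / lam)) with x by (field; lra); exact Hx.
Qed.

Lemma deviation_uniform_bound (g : (R -> CC) -> CC) (a b : CC) :
  tempered g ->
  (forall phi : R -> CC, schwartz phi ->
     exists K L0 : R, 0 < L0 /\ forall lam : R, L0 <= lam ->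
       Cmod (dilate g lam phi - RtoC (ln lam / lam) * b * phi 0)%C <= K / lam) ->
  exists (K : R) (N : nat) (L0 : R), 0 <= K /\ 1 <= L0 /\
    forall lam f M, L0 <= lam -> rschwartz f -> 0 < M -> seminorms_le N M f ->
      Cmod (deviation g a b lam f) <= K * M.
Proof.
  intros Hg HT.
  destruct (schwartz_uniform_boundedness (fun lam f => Cmod (rescaled g b lam f)))
    as (K & N & L0 & HK & HL & H).
  - intros lam f h Hl Hf Hh.
    replace (fun x => f x + h x) with (fun x => f x + 1 * h x) by (extensionality x; ring).
    rewrite rescaled_linear by assumption. rewrite Cmult_1_l. apply Cmod_triangle.
  - intros lam c f Hl Hf.
    (* Homogeneity is read off the single linearity lemma, with f in both places. *)
    replace (fun x => c * f x) with (fun x => f x + (c - 1) * f x) by (extensionality x; ring).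
    rewrite rescaled_linear by assumption.
    rewrite <- (Cmod_R c), <- Cmod_mult. f_equal. rewrite RtoC_minus. ring.
  - intros lam Hl. now apply rescaled_continuous.
  - intros f Hf. destruct (HT (fun x => RtoC (f x)) (schwartz_RtoC f Hf)) as (K & L0 & HL & H).
    exists K, L0. intros lam Hl. specialize (H lam Hl).
    assert (Hl0 : 0 < lam) by lra.
    replace (dilate g lam (fun x => RtoC (f x)) - RtoC (ln lam / lam) * b * RtoC (f 0))%C
      with (RtoC (/ lam) * rescaled g b lam f)%C in H.
    2: { unfold dilate, rescaled, Rdiv. rewrite !RtoC_mult. ring. }
    rewrite Cmod_mult, Cmod_R, Rabs_pos_eq in H by (left; now apply Rinv_0_lt_compat).
    apply Rmult_le_reg_l with (/ lam); [now apply Rinv_0_lt_compat|].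
    unfold Rdiv in H. lra.
  - destruct (limit_functional_bound a b) as (K' & HK' & H').
    (* The limit functional needs seminorms of order 1, and N may be 0. *)
    exists (K + K'), (S N), L0. split; [lra|split; [exact HL|]].
    intros lam f M Hl Hf HM Hs. unfold deviation, Cminus.
    eapply Rle_trans; [apply Cmod_triangle|]. rewrite Cmod_opp, Rmult_plus_distr_r.
    apply Rplus_le_compat.
    + apply H; auto. apply seminorms_le_weaken with (3 := Hs); [lia|lra].
    + apply H'; auto. apply seminorms_le_weaken with (3 := Hs); [lia|lra].
Qed.

(** * Cutoffs, truncation and weighted seminorm estimates *)

Lemma left_cutoff_exists : exists eta : R -> R, smooth eta /\ derivs_bounded eta /\
  (forall x, x <= -1 -> eta x = 0) /\ (forall x, - / 2 <= x -> eta x = 1).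
Proof.
  destruct smooth_step_exists as (s & Ss & H0 & H1).
  exists (fun x => s (2 * x + 2)).
  assert (S1 : smooth (fun x => s (2 * x + 2))).
  { apply (smooth_scale_arg 2 (fun x => s (x + 2))), smooth_translate, Ss. }
  assert (E0 : forall x, x <= -1 -> s (2 * x + 2) = 0) by (intros; apply H0; lra).
  assert (E1 : forall x, - / 2 <= x -> s (2 * x + 2) = 1) by (intros; apply H1; lra).
  split; [exact S1|split; [|split; assumption]].
  exact (derivs_bounded_of_eventually_const _ _ _ _ _ S1 E0 E1).
Qed.

Lemma outer_cutoff_exists : exists v : R -> R, smooth v /\ derivs_bounded v /\
  (forall x, Rabs x <= 1 -> v x = 0) /\ (forall x, 2 <= Rabs x -> v x = 1).
Proof.
  destruct smooth_step_exists as (s & Ss & H0 & H1).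
  set (v := fun x => s (x + -1) + s ((-1) * x + -1)).
  assert (S1 : smooth v).
  { apply smooth_plus; [now apply smooth_translate|].
    apply (smooth_scale_arg (-1) (fun x => s (x + -1))), smooth_translate, Ss. }
  assert (E0 : forall x, x <= -2 -> v x = 1).
  { intros x Hx. unfold v. rewrite (H0 (x + -1)), (H1 (-1 * x + -1)) by lra. ring. }
  assert (E1 : forall x, 2 <= x -> v x = 1).
  { intros x Hx. unfold v. rewrite (H1 (x + -1)), (H0 (-1 * x + -1)) by lra. ring. }
  exists v. split; [exact S1|split; [|split]].
  - exact (derivs_bounded_of_eventually_const _ _ _ _ _ S1 E0 E1).
  - intros x Hx. apply Rabs_le_between in Hx. unfold v.
    rewrite (H0 (x + -1)), (H0 (-1 * x + -1)) by lra. ring.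
  - intros x Hx. unfold Rabs in Hx. destruct (Rcase_abs x); [apply E0|apply E1]; lra.
Qed.

(** The tail r is v(x/X) f, which lives on |x| >= X. There one spare power of |x| gains 1/X, while
    the derivatives of v(x/X) stay bounded as X grows. *)
Lemma truncation (f : R -> R) (N : nat) (eps : R) : rschwartz f -> 0 < eps ->
  exists r X, rschwartz r /\ seminorms_le N eps r /\
    forall x, X <= Rabs x -> f x - r x = 0.
Proof.
  intros Hf Heps.
  destruct outer_cutoff_exists as (v & Sv & Bv & V0 & V1).
  destruct (Bv N) as (A & HA & HvA).
  (* Order N + 1 supplies the spare power of |x|. *)
  destruct (rschwartz_seminorms (S N) f Hf) as (M & HM & HfM).
  set (X := Rmax 1 (2 ^ N * (A * M) / eps)).
  assert (HX1 : 1 <= X) by apply Rmax_l.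
  assert (HX2 : 2 ^ N * (A * M) / X <= eps).
  { assert (H : 2 ^ N * (A * M) / eps <= X) by apply Rmax_r.
    apply Rmult_le_reg_r with X; [lra|].
    replace (2 ^ N * (A * M) / X * X) with (2 ^ N * (A * M) / eps * eps) by (field; lra).
    rewrite (Rmult_comm eps). apply Rmult_le_compat_r; lra. }
  assert (Hi : 0 < / X <= 1).
  { split; [apply Rinv_0_lt_compat; lra|]. rewrite <- Rinv_1. apply Rinv_le_contravar; lra. }
  assert (Sw : smooth (fun x => v (/ X * x))) by now apply smooth_scale_arg.
  assert (Hw : forall n B, (forall i x, (i <= n)%nat -> Rabs (Derive_n v i x) <= B) ->
            forall i x, (i <= n)%nat -> Rabs (Derive_n (fun x => v (/ X * x)) i x) <= B).
  { intros n B HB i x Hin. rewrite Derive_n_scale_arg by exact Sv.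
    rewrite Rabs_mult, Rabs_pos_eq by (apply pow_le; lra).
    specialize (HB i (/ X * x) Hin). pose proof (Rabs_pos (Derive_n v i (/ X * x))).
    assert ((/ X) ^ i <= 1) by (rewrite <- (pow1 i); apply pow_incr; lra).
    assert (0 <= (/ X) ^ i) by (apply pow_le; lra). nra. }
  exists (fun x => v (/ X * x) * f x), (2 * X). split; [|split].
  - apply rschwartz_mult; [exact Sw| |exact Hf].
    intros n. destruct (Bv n) as (B & HB & HvB). exists B. split; [exact HB|]. now apply Hw.
  - intros x k m Hk Hm.
    destruct (Rlt_le_dec (Rabs x) X) as [Hx|Hx].
    + rewrite (Derive_n_locally_zero _ m x (X - Rabs x)); [rewrite Rabs_R0; lra|lra|].
      intros y Hy. rewrite V0; [ring|].
      rewrite Rabs_mult, Rabs_pos_eq by lra.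
      assert (Rabs y <= X).
      { replace y with ((y - x) + x) by ring. eapply Rle_trans; [apply Rabs_triang|lra]. }
      apply Rmult_le_reg_l with X; [lra|]. rewrite <- Rmult_assoc, Rinv_r; lra.
    + assert (Hp : 0 < Rabs x ^ k) by (apply pow_lt; lra).
      assert (HD : Rabs (Derive_n (fun x => v (/ X * x) * f x) m x)
                   <= 2 ^ m * (A * (M / X / Rabs x ^ k))).
      { apply Derive_n_mult_bound; [exact Sw|apply Hf| |].
        - intros i Him. apply (Hw N A); [exact HvA|lia].
        - intros i Him. specialize (HfM x (S k) i ltac:(lia) ltac:(lia)).
          apply Rmult_le_reg_l with (X * Rabs x ^ k); [apply Rmult_lt_0_compat; lra|].
          replace (X * Rabs x ^ k * (M / X / Rabs x ^ k)) with M by (field; lra).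
          eapply Rle_trans; [|exact HfM]. simpl.
          apply Rmult_le_compat_r; [apply Rabs_pos|].
          apply Rmult_le_compat_r; lra. }
      apply Rle_trans with (2 ^ N * (A * M) / X); [|exact HX2].
      apply Rle_trans with (Rabs x ^ k * (2 ^ m * (A * (M / X / Rabs x ^ k)))).
      * apply Rmult_le_compat_l; lra.
      * replace (Rabs x ^ k * (2 ^ m * (A * (M / X / Rabs x ^ k))))
          with (2 ^ m * (A * M / X)) by (field; lra).
        replace (2 ^ N * (A * M) / X) with (2 ^ N * (A * M / X)) by (field; lra).
        apply Rmult_le_compat_r; [|apply Rle_pow; [lra|exact Hm]].
        apply Rdiv_le_0_compat; [now apply Rmult_le_pos|lra].
  - intros x Hx. rewrite V1; [ring|].
    rewrite Rabs_mult, Rabs_pos_eq by lra.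
    apply Rmult_le_reg_l with X; [lra|]. rewrite <- Rmult_assoc, Rinv_r; lra.
Qed.

(** The shift to x + 2 dominates |x| on [-1, oo) and is at least 1, so all powers up to N are below
    the N-th. The shift costs the factor e^{2y}. *)
Lemma pow_exp_bound (N k : nat) (x y : R) : 0 < y -> -1 <= x -> (k <= N)%nat ->
  Rabs x ^ k * exp (- (y * x)) <= INR N ^ N * exp (2 * y) / y ^ N.
Proof.
  intros Hy Hx Hk.
  assert (HyN : 0 < y ^ N) by now apply pow_lt.
  assert (H1 : Rabs x ^ k <= (x + 2) ^ N).
  { apply Rle_trans with ((x + 2) ^ k); [|apply Rle_pow; [lra|exact Hk]].
    apply pow_incr. split; [apply Rabs_pos|]. apply Rabs_le. lra. }
  assert (H2 := pow_le_exp N (y * (x + 2)) ltac:(apply Rmult_le_pos; lra)).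
  rewrite Rpow_mult_distr in H2.
  replace (y * (x + 2)) with (2 * y + y * x) in H2 by ring. rewrite exp_plus in H2.
  assert (E : exp (y * x) * exp (- (y * x)) = 1) by (rewrite <- exp_plus, Rplus_opp_r; apply exp_0).
  pose proof (exp_pos (- (y * x))) as He.
  apply Rle_trans with ((x + 2) ^ N * exp (- (y * x))); [apply Rmult_le_compat_r; lra|].
  apply Rmult_le_reg_l with (y ^ N); [exact HyN|].
  replace (y ^ N * (INR N ^ N * exp (2 * y) / y ^ N)) with (INR N ^ N * exp (2 * y) * 1) by (field; lra).
  rewrite <- E, <- !Rmult_assoc. apply Rmult_le_compat_r; [lra|].
  rewrite !Rmult_assoc in *. exact H2.
Qed.

(** The cutoff removes x < -1, and right of -1 the decay of h absorbs the powers of x. It is used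
    both for the exponentials e^{-yx} and, with y = 1, for the approximation errors. *)
Lemma cutoff_mult_seminorms (eta h : R -> R) (N : nat) (A B y : R) :
  smooth eta -> smooth h -> 0 <= A -> 0 <= B -> 0 < y ->
  (forall x, x <= -1 -> eta x = 0) ->
  (forall i x, (i <= N)%nat -> Rabs (Derive_n eta i x) <= A) ->
  (forall i x, (i <= N)%nat -> -1 <= x -> Rabs (Derive_n h i x) <= B * exp (- (y * x))) ->
  seminorms_le N (2 ^ N * A * (INR N ^ N * exp (2 * y) / y ^ N) * B) (fun x => eta x * h x).
Proof.
  intros Se Sh HA HB Hy H0 HeA HhB x k m Hk Hm.
  set (C := INR N ^ N * exp (2 * y) / y ^ N).
  assert (HC : 0 <= C).
  { apply Rdiv_le_0_compat; [|now apply pow_lt].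
    apply Rmult_le_pos; [apply pow_le, pos_INR|left; apply exp_pos]. }
  assert (H2 : 0 <= 2 ^ N) by (apply pow_le; lra).
  destruct (Rlt_le_dec x (-1)) as [Hx|Hx].
  - rewrite (Derive_n_locally_zero _ m x (-1 - x)).
    + rewrite Rabs_R0, Rmult_0_r. apply Rmult_le_pos; [|exact HB].
      apply Rmult_le_pos; [now apply Rmult_le_pos|exact HC].
    + lra.
    + intros t Ht. apply Rabs_def2 in Ht. rewrite H0 by lra. ring.
  - assert (HD : Rabs (Derive_n (fun x => eta x * h x) m x) <= 2 ^ m * (A * (B * exp (- (y * x))))).
    { apply Derive_n_mult_bound; auto.
      - intros i Hi; apply HeA; lia.
      - intros i Hi; apply HhB; [lia|exact Hx]. }
    assert (Hpe := pow_exp_bound N k x y Hy Hx Hk). fold C in Hpe.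
    apply Rle_trans with (Rabs x ^ k * (2 ^ m * (A * (B * exp (- (y * x)))))).
    { apply Rmult_le_compat_l; [apply abs_pow_ge_0|exact HD]. }
    replace (Rabs x ^ k * (2 ^ m * (A * (B * exp (- (y * x))))))
      with (2 ^ m * (A * B * (Rabs x ^ k * exp (- (y * x))))) by ring.
    replace (2 ^ N * A * C * B) with (2 ^ N * (A * B * C)) by ring.
    apply Rmult_le_compat.
    + apply pow_le; lra.
    + apply Rmult_le_pos; [now apply Rmult_le_pos|].
      apply Rmult_le_pos; [apply abs_pow_ge_0|left; apply exp_pos].
    + apply Rle_pow; [lra|exact Hm].
    + apply Rmult_le_compat_l; [now apply Rmult_le_pos|exact Hpe].
Qed.

Lemma rschwartz_cutoff_exp (eta : R -> R) (y : R) : smooth eta -> derivs_bounded eta ->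
  (forall x, x <= -1 -> eta x = 0) -> 0 < y ->
  rschwartz (fun x => eta x * exp (- (y * x))).
Proof.
  intros Se Be H0 Hy. destruct (smooth_exp_lin y) as [S1 D1].
  split; [now apply smooth_mult|].
  intros k m. destruct (Be (k + m)%nat) as (A & HA & HeA).
  (* A common bound for the factors y^i, i <= k + m, that the derivatives of e^{-yx} produce. *)
  set (B := Rmax 1 y ^ (k + m)).
  assert (H1 : 1 <= Rmax 1 y) by apply Rmax_l.
  eexists. intros x.
  apply (cutoff_mult_seminorms eta (fun x => exp (- (y * x))) (k + m) A B y); auto; try lia.
  - apply pow_le; lra.
  - intros i t Hi _. rewrite D1, Rabs_mult, (Rabs_pos_eq (exp _)) by (left; apply exp_pos).
    apply Rmult_le_compat_r; [left; apply exp_pos|].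
    rewrite <- RPow_abs, Rabs_Ropp, Rabs_pos_eq by lra.
    apply Rle_trans with (Rmax 1 y ^ i).
    + apply pow_incr. split; [lra|apply Rmax_r].
    + now apply Rle_pow.
Qed.

Lemma rschwartz_cutoff_exp_span (eta psi : R -> R) : smooth eta -> derivs_bounded eta ->
  (forall x, x <= -1 -> eta x = 0) -> exp_span psi -> rschwartz (fun x => eta x * psi x).
Proof.
  intros Se Be H0 Hpsi. induction Hpsi as [|c y psi Hy Hpsi IH].
  - replace (fun x => eta x * 0) with (fun _ : R => 0) by (extensionality x; ring).
    apply rschwartz_zero.
  - replace (fun x => eta x * (c * exp (- (y * x)) + psi x))
      with (fun x => c * (eta x * exp (- (y * x))) + eta x * psi x) by (extensionality x; ring).
    apply rschwartz_plus; [|exact IH].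
    apply (rschwartz_scal c (fun x => eta x * exp (- (y * x)))).
    now apply rschwartz_cutoff_exp.
Qed.

(** * Convergence on cutoff exponentials and on all Schwartz functions *)

Definition converges (g : (R -> CC) -> CC) (a b : CC) (f : R -> R) : Prop :=
  forall eps, 0 < eps -> exists L0, 1 <= L0 /\ forall lam, L0 <= lam ->
    Cmod (deviation g a b lam f) <= eps.

(** Dilating e^{-yx} by lam evaluates the Laplace transform at y/lam, where a + b ln(lam/y) loses
    its b ln lam to the Tauberian correction. What remains, a - b ln y, is the limit functional by
    [Pf_real_exp]. *)
Lemma converges_cutoff_exp (g : (R -> CC) -> CC) (a b : CC) (eta : R -> R) (y : R) :
  tempered g -> supported_nonneg g ->
  (forall eta : R -> R, cutoff eta ->
     forall eps : R, 0 < eps -> exists del : R, 0 < del /\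
       forall y : R, 0 < y < del ->
         Cmod (laplace g eta y - (a + b * RtoC (ln (/ y))))%C <= eps) ->
  smooth eta -> derivs_bounded eta ->
  (forall x, x <= -1 -> eta x = 0) -> (forall x, - / 2 <= x -> eta x = 1) -> 0 < y ->
  converges g a b (fun x => eta x * exp (- (y * x))).
Proof.
  intros Hg Hs HL Se Be H0 H1 Hy eps Heps.
  assert (Hcut : cutoff eta).
  { split; [exact Se|]. exists (-1), (- / 2). repeat split; auto; lra. }
  destruct (HL eta Hcut eps Heps) as (del & Hdel & H).
  (* The factor 2 makes y/lam < del strict. *)
  exists (Rmax 1 (2 * y / del)). split; [apply Rmax_l|]. intros lam Hlam.
  assert (Hl1 : 1 <= lam) by (eapply Rle_trans; [apply Rmax_l|exact Hlam]).
  assert (Hl2 : 2 * y / del <= lam) by (eapply Rle_trans; [apply Rmax_r|exact Hlam]).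
  assert (Hyl : 0 < y / lam) by (apply Rdiv_lt_0_compat; lra).
  assert (Hyd : y / lam < del).
  { apply Rmult_lt_reg_r with lam; [lra|].
    replace (y / lam * lam) with y by (field; lra).
    apply Rmult_le_compat_l with (r := del) in Hl2; [|lra].
    replace (del * (2 * y / del)) with (2 * y) in Hl2 by (field; lra). lra. }
  specialize (H (y / lam) (conj Hyl Hyd)).
  assert (Hf : rschwartz (fun x => eta x * exp (- (y * x)))) by now apply rschwartz_cutoff_exp.
  assert (Hfl : rschwartz (fun x => eta x * exp (- (y / lam * x)))) by now apply rschwartz_cutoff_exp.
  assert (Hfd := rschwartz_dilate lam _ Hl1 Hf). cbv beta in Hfd.
  assert (Eg : g (fun x => RtoC (eta (x / lam) * exp (- (y * (x / lam))))) = laplace g eta (y / lam)).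
  { unfold laplace.
    (* Dilation also stretches the cutoff. The difference between the stretched and the original
       cutoff exponential lives on [-lam, -1/2], so g does not see it. *)
    pose proof (tempered_real_linear g _ _ (-1) Hg Hfd Hfl) as E. cbv beta in E.
    rewrite Hs in E.
    - replace (g (fun x => RtoC (eta (x / lam) * exp (- (y * (x / lam))))))
        with (0 - RtoC (-1) * g (fun x => RtoC (eta x * exp (- (y / lam * x)))))%C
        by (rewrite E; ring).
      change (RtoC (-1)) with (RtoC (- (1))). rewrite RtoC_opp. ring.
    - apply schwartz_RtoC.
      apply (rschwartz_plus _ (fun x => -1 * (eta x * exp (- (y / lam * x)))));
        [exact Hfd|now apply rschwartz_scal].
    - exists (- lam), (- / 2). split; [lra|]. intros x Hx.
      replace (- (y * (x / lam))) with (- (y / lam * x)) by (field; lra).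
      destruct Hx as [Hx|Hx].
      + rewrite (H0 (x / lam)), (H0 x) by
          (lra || (apply Rmult_le_reg_r with lam; [lra|];
                   replace (x / lam * lam) with x by (field; lra); lra)).
        unfold RtoC. f_equal. ring.
      + rewrite (H1 (x / lam)), (H1 x) by
          (lra || (apply Rmult_le_reg_r with lam; [lra|];
                   replace (x / lam * lam) with x by (field; lra); lra)).
        unfold RtoC. f_equal. ring. }
  replace (deviation g a b lam (fun x => eta x * exp (- (y * x))))
    with (laplace g eta (y / lam) - (a + b * RtoC (ln (/ (y / lam)))))%C; [exact H|].
  unfold deviation, rescaled, limit_functional. rewrite Eg.
  rewrite (Pf_real_exp _ y Hy Hf) by (intros; rewrite H1 by lra; ring).
  rewrite Rmult_0_r, Ropp_0, exp_0, (H1 0) by lra.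
  rewrite ln_Rinv by exact Hyl. rewrite ln_div by lra.
  replace (- (ln y - ln lam)) with (ln lam - ln y) by ring.
  rewrite !Rmult_1_r. unfold Rminus. rewrite !RtoC_plus, !RtoC_opp. ring.
Qed.

Lemma converges_zero (g : (R -> CC) -> CC) (a b : CC) : supported_nonneg g ->
  converges g a b (fun _ => 0).
Proof.
  intros Hs eps Heps. exists 1. split; [lra|]. intros lam Hl.
  rewrite (deviation_negative_support g a b lam (fun _ => 0) (-1) (-1) Hs Hl rschwartz_zero);
    [rewrite Cmod_0; lra|lra|reflexivity].
Qed.

Lemma converges_plus_scal (g : (R -> CC) -> CC) (a b : CC) (c : R) (f h : R -> R) :
  tempered g -> rschwartz f -> rschwartz h -> converges g a b f -> converges g a b h ->
  converges g a b (fun x => f x + c * h x).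
Proof.
  intros Hg Hf Hh Cf Ch eps Heps.
  pose proof (Rabs_pos c) as Hc.
  destruct (Cf (eps / 2) ltac:(lra)) as (L1 & HL1 & H1).
  destruct (Ch (eps / 2 / (Rabs c + 1)) ltac:(apply Rdiv_lt_0_compat; lra)) as (L2 & HL2 & H2).
  exists (Rmax L1 L2). split; [eapply Rle_trans; [exact HL1|apply Rmax_l]|].
  intros lam Hl.
  pose proof (Rmax_l L1 L2). pose proof (Rmax_r L1 L2).
  specialize (H1 lam ltac:(lra)). specialize (H2 lam ltac:(lra)).
  rewrite deviation_linear by (assumption || lra).
  eapply Rle_trans; [apply Cmod_triangle|]. rewrite Cmod_mult, Cmod_R.
  apply (Rmult_le_compat_l (Rabs c + 1)) in H2; [|lra].
  replace ((Rabs c + 1) * (eps / 2 / (Rabs c + 1))) with (eps / 2) in H2 by (field; lra).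
  pose proof (Cmod_ge_0 (deviation g a b lam h)). nra.
Qed.

Lemma converges_cutoff_exp_span (g : (R -> CC) -> CC) (a b : CC) (eta psi : R -> R) :
  tempered g -> supported_nonneg g ->
  smooth eta -> derivs_bounded eta -> (forall x, x <= -1 -> eta x = 0) ->
  (forall y, 0 < y -> converges g a b (fun x => eta x * exp (- (y * x)))) ->
  exp_span psi -> converges g a b (fun x => eta x * psi x).
Proof.
  intros Hg Hs Se Be H0 Hexp Hpsi. induction Hpsi as [|c y psi Hy Hpsi IH].
  - replace (fun x => eta x * 0) with (fun _ : R => 0) by (extensionality x; ring).
    now apply converges_zero.
  - replace (fun x => eta x * (c * exp (- (y * x)) + psi x))
      with (fun x => eta x * psi x + c * (eta x * exp (- (y * x)))) by (extensionality x; ring).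
    apply (converges_plus_scal g a b c (fun x => eta x * psi x) (fun x => eta x * exp (- (y * x))));
      auto using rschwartz_cutoff_exp, rschwartz_cutoff_exp_span.
Qed.

(** The function splits as f = r + n + r2 + eta psi: the tail r and the cut-off approximation error
    r2 are small in the seminorms that control the deviation uniformly in lam, n lives on the
    negative axis, and the exponential sum converges. *)
Lemma converges_schwartz (g : (R -> CC) -> CC) (a b : CC) (f : R -> R) :
  tempered g -> supported_nonneg g ->
  (forall eta : R -> R, cutoff eta ->
     forall eps : R, 0 < eps -> exists del : R, 0 < del /\
       forall y : R, 0 < y < del ->
         Cmod (laplace g eta y - (a + b * RtoC (ln (/ y))))%C <= eps) ->
  (forall phi : R -> CC, schwartz phi ->
     exists K L0 : R, 0 < L0 /\ forall lam : R, L0 <= lam ->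
       Cmod (dilate g lam phi - RtoC (ln lam / lam) * b * phi 0)%C <= K / lam) ->
  rschwartz f -> converges g a b f.
Proof.
  intros Hg Hs HL HT Hf eps Heps.
  destruct (deviation_uniform_bound g a b Hg HT) as (K & N & L0 & HK & HL0 & Hunif).
  destruct left_cutoff_exists as (eta & Se & Be & H0 & H1).
  destruct (Be N) as (A & HA & HeA).
  set (d := eps / 3 / (K + 1)).
  assert (Hd : 0 < d) by (apply Rdiv_lt_0_compat; lra).
  assert (HKd : K * d <= eps / 3).
  { replace (eps / 3) with ((K + 1) * d) by (unfold d; field; lra).
    apply Rmult_le_compat_r; lra. }
  destruct (truncation f N d Hf Hd) as (r & X & Hr & Hsr & HX).
  (* The constant of [cutoff_mult_seminorms] at y = 1; an approximation within B e^{-x} then yields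
     seminorms at most C B <= d. *)
  set (C := 2 ^ N * A * (INR N ^ N * exp (2 * 1) / 1 ^ N)).
  assert (HC : 0 <= C).
  { apply Rmult_le_pos; [apply Rmult_le_pos; [apply pow_le; lra|exact HA]|].
    apply Rdiv_le_0_compat; [|rewrite pow1; lra].
    apply Rmult_le_pos; [apply pow_le, pos_INR|left; apply exp_pos]. }
  set (B := d / (C + 1)).
  assert (HB : 0 < B) by (apply Rdiv_lt_0_compat; lra).
  assert (HCB : C * B <= d).
  { replace d with ((C + 1) * B) by (unfold B; field; lra). apply Rmult_le_compat_r; lra. }
  assert (Ht : rschwartz (fun x => f x - r x)) by now apply rschwartz_minus.
  destruct (exp_span_approx N (fun x => f x - r x) X B) as (psi & Hpsi & Happ).
  { apply Ht. }
  { intros x Hx. apply HX. eapply Rle_trans; [exact Hx|apply Rle_abs]. }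
  { exact HB. }
  assert (Hep : rschwartz (fun x => eta x * psi x)) by now apply rschwartz_cutoff_exp_span.
  assert (Het : rschwartz (fun x => eta x * (f x - r x))) by now apply rschwartz_mult.
  set (r2 := fun x => eta x * (f x - r x - psi x)).
  assert (Hr2 : rschwartz r2).
  { replace r2 with (fun x => eta x * (f x - r x) - eta x * psi x)
      by (extensionality x; unfold r2; ring).
    now apply rschwartz_minus. }
  assert (Hsr2 : seminorms_le N d r2).
  { apply seminorms_le_weaken with N (C * B); [lia|exact HCB|].
    apply (cutoff_mult_seminorms eta (fun x => f x - r x - psi x) N A B 1); auto; try lra.
    - apply (smooth_minus (fun x => f x - r x)); [apply Ht|now apply exp_span_smooth].
    - intros i x Hi Hx. rewrite Rmult_1_l. now apply Happ. }
  set (n := fun x => (f x - r x) - eta x * (f x - r x)).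
  assert (Hn : rschwartz n) by now apply rschwartz_minus.
  destruct (converges_cutoff_exp_span g a b eta psi Hg Hs Se Be H0) with (eps := eps / 3)
    as (L1 & HL1 & Hc); [|exact Hpsi|lra|].
  { intros y Hy. now apply converges_cutoff_exp. }
  exists (Rmax L0 L1). split; [eapply Rle_trans; [exact HL0|apply Rmax_l]|].
  intros lam Hlam.
  pose proof (Rmax_l L0 L1). pose proof (Rmax_r L0 L1).
  assert (Hl1 : 1 <= lam) by lra.
  assert (E : f = fun x => r x + (n x + (r2 x + eta x * psi x))).
  { extensionality x. unfold n, r2. ring. }
  assert (S1 : rschwartz (fun x => r2 x + eta x * psi x)) by now apply rschwartz_plus.
  assert (S2 : rschwartz (fun x => n x + (r2 x + eta x * psi x))) by now apply rschwartz_plus.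
  rewrite E.
  rewrite (deviation_plus g a b lam r (fun x => n x + (r2 x + eta x * psi x))) by assumption.
  rewrite (deviation_plus g a b lam n (fun x => r2 x + eta x * psi x)) by assumption.
  rewrite (deviation_plus g a b lam r2 (fun x => eta x * psi x)) by assumption.
  (* Left of -X the truncated function vanishes, and right of -1/2 the cutoff is 1; in both cases n
     is 0. *)
  rewrite (deviation_negative_support g a b lam n (Rmin (- X) (- / 2)) (- / 2) Hs Hl1 Hn).
  - rewrite Cplus_0_l.
    eapply Rle_trans; [apply Cmod_triangle|].
    eapply Rle_trans; [apply Rplus_le_compat_l, Cmod_triangle|].
    pose proof (Hunif lam r d ltac:(lra) Hr Hd Hsr) as B1.
    pose proof (Hunif lam r2 d ltac:(lra) Hr2 Hd Hsr2) as B2.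
    pose proof (Hc lam ltac:(lra)) as B3. lra.
  - lra.
  - intros x [Hx|Hx]; unfold n.
    + assert (x <= - X) by (eapply Rle_trans; [exact Hx|apply Rmin_l]).
      rewrite HX; [ring|]. eapply Rle_trans; [|apply Rabs_maj2]. lra.
    + rewrite H1 by exact Hx. ring.
Qed.

Theorem theorem3p5 (g : (R -> CC) -> CC) (a b : CC) :
  tempered g ->
  supported_nonneg g ->
  (* L{g;y} = a + b log(1/y) + o(1), y -> 0+ *)
  (forall eta : R -> R, cutoff eta ->
     forall eps : R, 0 < eps -> exists del : R, 0 < del /\
       forall y : R, 0 < y < del ->
         Cmod (laplace g eta y - (a + b * RtoC (ln (/ y))))%C <= eps) ->
  (* g(lambda x) - b log(lambda) delta(x)/lambda = O(1/lambda) in S' *)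
  (forall phi : R -> CC, schwartz phi ->
     exists K L0 : R, 0 < L0 /\ forall lam : R, L0 <= lam ->
       Cmod (dilate g lam phi - RtoC (ln lam / lam) * b * phi 0)%C <= K / lam) ->
  (* conclusion, o(1/lambda) in S' *)
  forall phi : R -> CC, schwartz phi ->
    forall eps : R, 0 < eps -> exists L0 : R, 0 < L0 /\ forall lam : R, L0 <= lam ->
      Cmod (dilate g lam phi
            - (RtoC (/ lam) * (a + b * RtoC euler_gamma) * phi 0
               + RtoC (ln lam / lam) * b * phi 0
               + RtoC (/ lam) * b * Pf_H_over_x phi))%C <= eps / lam.
Proof.
  intros Hg Hs HL HT phi Hphi eps Heps.
  destruct (schwartz_parts phi Hphi) as [Hre Him].
  set (f := fun x => Re (phi x)) in *. set (h := fun x => Im (phi x)) in *.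
  (* Real and imaginary parts of the test function get half of eps each. *)
  destruct (converges_schwartz g a b f Hg Hs HL HT Hre (eps / 2) ltac:(lra)) as (L1 & HL1 & H1).
  destruct (converges_schwartz g a b h Hg Hs HL HT Him (eps / 2) ltac:(lra)) as (L2 & HL2 & H2).
  exists (Rmax L1 L2). pose proof (Rmax_l L1 L2). pose proof (Rmax_r L1 L2).
  split; [lra|]. intros lam Hlam.
  specialize (H1 lam ltac:(lra)). specialize (H2 lam ltac:(lra)).
  assert (Hdec : forall z : CC, z = (RtoC (Re z) + Ci * RtoC (Im z))%C).
  { intros [u v]. unfold RtoC, Ci, Cplus, Cmult; simpl. f_equal; ring. }
  assert (E0 : phi 0 = (RtoC (f 0) + Ci * RtoC (h 0))%C) by apply Hdec.
  assert (EPf : Pf_H_over_x phi = (RtoC (Pf_real f) + Ci * RtoC (Pf_real h))%C).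
  { rewrite (Pf_H_over_x_pair phi Hre Him). apply Hdec. }
  assert (Eg : g (fun x => phi (x / lam)) =
            (g (fun x => RtoC (f (x / lam)%R)) + Ci * g (fun x => RtoC (h (x / lam)%R)))%C).
  { destruct Hg as (Hadd & Hscal & _).
    assert (Sf : schwartz (fun x => RtoC (f (x / lam))))
      by (apply schwartz_RtoC, rschwartz_dilate; [lra|exact Hre]).
    assert (Sh : schwartz (fun x => RtoC (h (x / lam))))
      by (apply schwartz_RtoC, rschwartz_dilate; [lra|exact Him]).
    rewrite <- Hscal by exact Sh. rewrite <- Hadd; [|exact Sf|].
    - f_equal. extensionality x. apply Hdec.
    (* Additivity of g also needs that i h is Schwartz; its seminorms are those of h because |i| =
       1. *)
    - replace (fun x => (Ci * RtoC (h (x / lam)%R))%C) with (fun x => (0, h (x / lam)) : CC).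
      2: { extensionality x. unfold Ci, RtoC, Cmult; simpl. f_equal; ring. }
      destruct (rschwartz_dilate lam h ltac:(lra) Him) as [S1 D1].
      split; [exact (smooth_const 0)|split; [exact S1|]].
      intros k m. destruct (D1 k m) as [M HM]. exists M. intros x.
      replace (cderive_n _ m x) with (Ci * RtoC (Derive_n (fun x => h (x / lam)%R) m x))%C.
      + rewrite Cmod_mult, Cmod_R.
        replace (Cmod Ci) with 1; [rewrite Rmult_1_l; apply HM|].
        unfold Cmod, Ci; simpl. rewrite <- sqrt_1 at 1. f_equal. ring.
      + unfold cderive_n, Ci, RtoC, Cmult; simpl. f_equal; [|ring].
        rewrite Derive_n_zero. ring. }
  (* The remainder is exactly 1/lam times the deviation at f plus i times the deviation at h, so
     convergence of the deviations to 0 is the required o(1/lam). *)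
  match goal with |- Cmod ?z <= _ =>
    replace z with (RtoC (/ lam) * (deviation g a b lam f + Ci * deviation g a b lam h))%C end.
  2: { unfold dilate, deviation, rescaled, limit_functional.
       rewrite E0, EPf, Eg. unfold Rdiv. rewrite !RtoC_mult. ring. }
  assert (Hi : 0 < / lam) by (apply Rinv_0_lt_compat; lra).
  rewrite Cmod_mult, Cmod_R, Rabs_pos_eq by lra.
  unfold Rdiv. rewrite Rmult_comm. apply Rmult_le_compat_r; [lra|].
  eapply Rle_trans; [apply Cmod_triangle|]. rewrite Cmod_mult.
  replace (Cmod Ci) with 1; [lra|].
  unfold Cmod, Ci; simpl. rewrite <- sqrt_1 at 1. f_equal. ring.
Qed.
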